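(* Consider on $T^*\mathrm{Vol}(M)\simeq\mathrm{Vol}(M)\times C^\infty(M)$ the Hamiltonian $$H(\varrho,\theta)=\frac12\int_M|\nabla\theta|^2\varrho+\frac{1}{2m}\left(\int_M\theta\varrho\right)^2,\qquad m=\int_M\varrho .$$ The geodesic equations in Hamiltonian form for $H$, i.e. Hamilton's equations $\dot\varrho=\delta H/\delta\theta$, $\dot\theta=-\delta H/\delta\varrho$, are given by $$\dot\rho=-\operatorname{div}(\rho\nabla\theta)+\xi\rho,$$ $$\dot\theta=-\frac12|\nabla\theta|^2-\xi\theta+\frac{\xi^2}{2},$$ where $\varrho=\rho\mu$ and $\xi=\frac1m\int_M\theta\varrho$.
   Context: $M$ is a compact connected Riemannian manifold without boundary with (Riemannian) volume form $\mu$ of total mass $\int_M\mu=1$. $\mathrm{Vol}(M)$ is the space of all smooth (un-normalized) volume forms on $M$, regarded as positive densities $\varrho=\rho\mu$ with $\rho>0$ smooth. $\operatorname{div}$ is the divergence with respect to $\mu$; $\nabla$ and $|\cdot|$ refer to the Riemannian metric of $M$. The (smooth) cotangent space of $\mathrm{Vol}(M)$ at $\varrho$ is identified with $C^\infty(M)$ via the pairing $\langle\dot\varrho,\theta\rangle=\int_M\theta\dot\varrho$. The variational derivatives are defined by this pairing: $\frac{d}{d\epsilon}|_{\epsilon=0}H(\varrho,\theta+\epsilon\,\delta\theta)=\int_M\delta\theta\,\frac{\delta H}{\delta\theta}$ (with $\delta H/\delta\theta$ a density) and $\frac{d}{d\epsilon}|_{\epsilon=0}H(\varrho+\epsilon\,\delta\varrho,\theta)=\int_M\frac{\delta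 H}{\delta\varrho}\,\delta\varrho$ (with $\delta H/\delta\varrho$ a function). This $H$ is the Hamiltonian of the metric $\bar{\mathcal{G}}$ on $\mathrm{Vol}(M)$ given by $\bar{\mathcal{G}}_\varrho(\dot\varrho,\dot\varrho)=\int_M(|\nabla\theta|^2+\xi^2)\varrho$, where $\dot\rho=-\operatorname{div}(\rho\nabla\theta)+\xi\rho$ and $\int_M\dot\varrho=m\xi$. *)

(* Defs.v *)
From HB Require Import structures.
From mathcomp Require Import all_boot all_order all_algebra.
From mathcomp Require Import all_classical all_reals all_analysis.

Set Implicit Arguments.
Unset Strict Implicit.
Unset Printing Implicit Defensive.

Import Order.TTheory GRing.Theory Num.Theory.
Import numFieldNormedType.Exports.
Local Open Scope classical_set_scope.
Local Open Scope ring_scope.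

Definition partial (R : realType) (n : nat) (i : 'I_n) (f : 'rV[R]_n -> R)
    (u : 'rV[R]_n) : R :=
  'D_(delta_mx 0 i : 'rV[R]_n) f u.

(* Meaningful for [U] open: [f] need not be controlled outside [U]. *)
Fixpoint Ck_on (R : realType) (n k : nat) (U : set 'rV[R]_n)
    (f : 'rV[R]_n -> R) : Prop :=
  (forall u, U u -> {for u, continuous f}) /\
  match k with
  | 0%N => True
  | k'.+1 =>
      forall i : 'I_n,
        (forall u, U u -> derivable f u (delta_mx 0 i : 'rV[R]_n)) /\
        Ck_on k' U (partial i f)
  end.

Definition smooth_on (R : realType) (n : nat) (U : set 'rV[R]_n)
    (f : 'rV[R]_n -> R) : Prop :=
  forall k : nat, Ck_on k U f.

(* Iterated one-dimensional Lebesgue integral. It is only applied below to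
   continuous compactly supported functions, for which, by Fubini, it is the
   integral with respect to the n-dimensional Lebesgue measure. *)
Fixpoint integral_rV (R : realType) (n : nat) : ('rV[R]_n -> R) -> R :=
  match n return ('rV[R]_n -> R) -> R with
  | 0%N => fun f => f 0
  | n'.+1 => fun f =>
      \int[@lebesgue_measure R]_t
        integral_rV (fun v : 'rV[R]_n' => f (row_mx (const_mx t : 'rV[R]_1) v))
  end.

(* [coord c] and [param c] are mutually inverse homeomorphisms between the
   open sets [dom c] and [coord c @` dom c]; their values outside of these
   sets are irrelevant. The atlas need not be maximal. The carrier is
   nonempty, as [ptopologicalType] provides a point. *)
Record smoothManifold (R : realType) (n : nat) := SmoothManifold {
  carrier :> ptopologicalType ;
  manifold_hausdorff : hausdorff_space carrier ;
  manifold_second_countable : @second_countable carrier ;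
  chart : Type ;
  dom : chart -> set carrier ;
  coord : chart -> carrier -> 'rV[R]_n ;
  param : chart -> 'rV[R]_n -> carrier ;
  chart_at : carrier -> chart ;
  chart_atP : forall x, dom (chart_at x) x ;
  open_dom : forall c, open (dom c) ;
  open_img : forall c, open (coord c @` dom c) ;
  coordK : forall c x, dom c x -> param c (coord c x) = x ;
  continuous_coord : forall c x, dom c x -> {for x, continuous (coord c)} ;
  continuous_param : forall c u, (coord c @` dom c) u ->
    {for u, continuous (param c)} ;
  smooth_transition : forall (c d : chart) (j : 'I_n),
    smooth_on (coord c @` (dom c `&` dom d))
      (fun u => coord d (param c u) 0 j)
}.

Definition img (R : realType) (n : nat) (M : smoothManifold R n)
    (c : chart M) : set 'rV[R]_n :=
  coord c @` dom c.

Definition smooth (R : realType) (n : nat) (M : smoothManifold R n)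
    (f : M -> R) : Prop :=
  forall c : chart M, smooth_on (img c) (fun u => f (param c u)).

(* Joint smoothness on [I * M] in time and space, with [I] open: a smooth
   curve in the space of smooth functions on a compact [M]. The first
   coordinate of a vector of [R^(1+n)] is the time. *)
Definition smooth_curve (R : realType) (n : nat) (M : smoothManifold R n)
    (I : set R) (f : R -> M -> R) : Prop :=
  forall c : chart M,
    smooth_on [set w : 'rV[R]_(1 + n) | I (lsubmx w 0 0) /\ img c (rsubmx w)]
      (fun w => f (lsubmx w 0 0) (param c (rsubmx w))).

(* [jacobian_coord c d u i j] is the derivative of the [j]-th [d]-coordinate
   along the [i]-th [c]-coordinate. *)
Definition jacobian_coord (R : realType) (n : nat) (M : smoothManifold R n)
    (c d : chart M) (u : 'rV[R]_n) : 'M[R]_n :=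
  \matrix_(i, j) partial i (fun v => coord d (param c v) 0 j) u.

(* [gmx c u] is the Gram matrix of the coordinate frame of [c] at the point of
   coordinates [u]; [gmx_compat] is the transformation law of a (0,2)-tensor. *)
Record riemannianMetric (R : realType) (n : nat) (M : smoothManifold R n) :=
  RiemannianMetric {
  gmx :> chart M -> 'rV[R]_n -> 'M[R]_n ;
  smooth_gmx : forall c i j, smooth_on (img c) (fun u => gmx c u i j) ;
  gmx_sym : forall c u, img c u -> (gmx c u)^T = gmx c u ;
  gmx_posdef : forall c u, img c u ->
    forall v : 'rV[R]_n, v != 0 -> 0 < (v *m gmx c u *m v^T) 0 0 ;
  gmx_compat : forall (c d : chart M) x, dom c x -> dom d x ->
    gmx c (coord c x) =
      jacobian_coord c d (coord c x) *m gmx d (coord d x)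
        *m (jacobian_coord c d (coord c x))^T
}.

(* A vector field is given by its components in every chart. *)
Definition vfield (R : realType) (n : nat) (M : smoothManifold R n) : Type :=
  chart M -> 'rV[R]_n -> 'rV[R]_n.

Definition scale_vfield (R : realType) (n : nat) (M : smoothManifold R n)
    (f : M -> R) (X : vfield M) : vfield M :=
  fun c u => f (param c u) *: X c u.

Definition grad (R : realType) (n : nat) (M : smoothManifold R n)
    (g : riemannianMetric M) (f : M -> R) : vfield M :=
  fun c u => (\row_j partial j (fun v => f (param c v)) u) *m invmx (g c u).

Definition normsq (R : realType) (n : nat) (M : smoothManifold R n)
    (g : riemannianMetric M) (X : vfield M) (x : M) : R :=
  let c := chart_at x in let u := coord c x in
  (X c u *m g c u *m (X c u)^T) 0 0.

Definition vol_density (R : realType) (n : nat) (M : smoothManifold R n)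
    (g : riemannianMetric M) (c : chart M) (u : 'rV[R]_n) : R :=
  Num.sqrt (\det (g c u)).

(* The divergence with respect to the Riemannian volume, whose local
   expression is [vol_density g c] times the Lebesgue measure. *)
Definition div (R : realType) (n : nat) (M : smoothManifold R n)
    (g : riemannianMetric M) (X : vfield M) (x : M) : R :=
  let c := chart_at x in let u := coord c x in
  (vol_density g c u)^-1 *
    \sum_(i < n) partial i (fun v => vol_density g c v * X c v 0 i) u.

Definition borel (T : ptopologicalType) := g_sigma_algebraType (@open T).

(* By the Riesz theorem and a partition of unity, at most one finite Borel
   measure on a compact [M] has these integrals over chart domains. No
   orientation is involved: volume forms are regarded as densities. *)
Definition is_riemannian_volume (R : realType) (n : nat)
    (M : smoothManifold R n) (g : riemannianMetric M)
    (mu : {measure set (borel M) -> \bar R}) : Prop :=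
  forall (c : chart M) (f : M -> R),
    continuous f -> closure [set x | f x != 0] `<=` dom c ->
    \int[mu]_x f x =
      integral_rV (patch (fun=> 0) (img c)
        (fun u => f (param c u) * vol_density g c u)).

(* A density [rho * mu] is represented by the function [rho]. *)
Definition is_volume_form (R : realType) (n : nat) (M : smoothManifold R n)
    (rho : M -> R) : Prop :=
  smooth rho /\ forall x, 0 < rho x.

Definition mass (R : realType) (n : nat) (M : smoothManifold R n)
    (mu : {measure set (borel M) -> \bar R}) (rho : M -> R) : R :=
  \int[mu]_x rho x.

Definition xi (R : realType) (n : nat) (M : smoothManifold R n)
    (mu : {measure set (borel M) -> \bar R}) (rho theta : M -> R) : R :=
  (mass mu rho)^-1 * \int[mu]_x (theta x * rho x).

Definition hamiltonian (R : realType) (n : nat) (M : smoothManifold R n)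
    (g : riemannianMetric M) (mu : {measure set (borel M) -> \bar R})
    (rho theta : M -> R) : R :=
  2^-1 * \int[mu]_x (normsq g (grad g theta) x * rho x) +
  (2 * mass mu rho)^-1 * (\int[mu]_x (theta x * rho x)) ^+ 2.

(* [D] is the density, with respect to [mu], of the variational derivative of
   [H] in the direction of the fibre. *)
Definition is_vderiv_theta (R : realType) (n : nat) (M : smoothManifold R n)
    (mu : {measure set (borel M) -> \bar R})
    (H : (M -> R) -> (M -> R) -> R) (rho theta D : M -> R) : Prop :=
  smooth D /\
  forall dtheta : M -> R, smooth dtheta ->
    is_derive (0 : R) (1 : R)
      (fun e : R => H rho (fun x => theta x + e * dtheta x))
      (\int[mu]_x (dtheta x * D x)).

(* The tangent vectors to Vol(M) are all the smooth densities. As [M] is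
   compact, [rho + e * drho] is positive for [e] close to 0. *)
Definition is_vderiv_rho (R : realType) (n : nat) (M : smoothManifold R n)
    (mu : {measure set (borel M) -> \bar R})
    (H : (M -> R) -> (M -> R) -> R) (rho theta D : M -> R) : Prop :=
  smooth D /\
  forall drho : M -> R, smooth drho ->
    is_derive (0 : R) (1 : R)
      (fun e : R => H (fun x => rho x + e * drho x) theta)
      (\int[mu]_x (D x * drho x)).

Definition time_deriv (R : realType) (T : Type) (f : R -> T -> R) (t : R)
    (x : T) : R :=
  derive1 (fun s : R => f s x) t.

Definition hamilton_equations (R : realType) (n : nat)
    (M : smoothManifold R n) (mu : {measure set (borel M) -> \bar R})
    (H : (M -> R) -> (M -> R) -> R) (rho theta : R -> M -> R) (t : R) : Prop :=
  is_vderiv_theta mu H (rho t) (theta t) (time_deriv rho t) /\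
  is_vderiv_rho mu H (rho t) (theta t) (fun x => - time_deriv theta t x).

(* Main.v *)
(* Along lines theta + e * phi the Hamiltonian is a quadratic polynomial in e,
   and along lines rho + e * phi a rational function of e, so both variational
   derivatives are computed explicitly. The only geometric input is the
   divergence theorem: the integral of (grad theta . grad phi) rho equals minus
   the integral of phi div(rho grad theta). A partition of unity reduces it to
   integration by parts in one chart, where the integral of a partial derivative
   vanishes by invariance of the iterated integral under translations. This local
   form also shows, without the transformation rule of the volume density, that
   the divergence does not depend on the chart, hence is smooth. Conversely a
   variational derivative is unique: test it against the difference of two
   candidates, and use that the volume charges every nonempty open set. *)
From Pilot Require Import Defs.
From HB Require Import structures.
From mathcomp Require Import all_boot all_order all_algebra.
From mathcomp Require Import all_classical all_reals all_analysis.
From mathcomp Require Import finmap measurable_realfun.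
From mathcomp Require Import ring lra.
From mathcomp Require polyrcf.

Set Implicit Arguments.
Unset Strict Implicit.
Unset Printing Implicit Defensive.

Import Order.TTheory GRing.Theory Num.Theory.
Import numFieldNormedType.Exports.
Local Open Scope classical_set_scope.
Local Open Scope ring_scope.

(* MathComp shadows [coord]. *)
Import Pilot.Defs.

(** * Functions of class C^k on open subsets of R^n *)

(** Three features of the definitions shape the proof. Regularity is stated through iterated partial
    derivatives, so the chain rule, on which every change of chart rests, first needs total
    differentiability, recovered from continuous partials. The volume is known only through
    integrals of continuous functions supported in one chart domain, and these are iterated
    integrals; linearity, a sup bound and strict positivity are therefore proved by induction on the
    dimension, with no exchange of integrals and no change of variables. Finally, [div] at [x] is
    computed in [chart_at x], a chart that may vary with [x] in an uncontrolled way, so that a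
    priori [div] is not even continuous. This is why integration by parts is carried out for the
    coordinate expression in one fixed chart before [div] itself is put under an integral. *)

Lemma Ck_on_local (R : realType) (n k : nat) (U : set 'rV[R]_n) f :
  (forall u, U u -> exists2 V : set 'rV[R]_n, V u & Ck_on k V f) ->
  Ck_on k U f.
Proof.
(* Every clause of [Ck_on] concerns neighbourhoods, in the whole space, of one point at a time; so
   the pieces [V] may be arbitrary sets. *)
elim: k f => [|k IH] f Uf /=; split=> //.
- by move=> u /Uf[V Vu [cf _]]; exact: cf.
- by move=> u /Uf[V Vu [cf _]]; exact: cf.
- move=> i; split; first by move=> u /Uf[V Vu [_ /(_ i)[df _]]]; exact: df.
  by apply: IH => u /Uf[V Vu [_ /(_ i)[_ pf]]]; exists V.
Qed.

Lemma Ck_on_continuous (R : realType) (n k : nat) (U : set 'rV[R]_n) f :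
  Ck_on k U f -> forall u, U u -> {for u, continuous f}.
Proof. by case: k => [|k] []. Qed.

Lemma Ck_onW (R : realType) (n k : nat) (U : set 'rV[R]_n) f :
  Ck_on k.+1 U f -> Ck_on k U f.
Proof.
elim: k f => [|k IH] f [cf hf]; split=> // i.
by have [df hp] := hf i; split=> //; exact: IH.
Qed.

Lemma Ck_on_leq (R : realType) (n k l : nat) (U : set 'rV[R]_n) f :
  (k <= l)%N -> Ck_on l U f -> Ck_on k U f.
Proof. by move=> /subnK <-; elim: (l - k)%N => // m IH /Ck_onW. Qed.

Lemma open_near_eq (R : realType) (n : nat) (U : set 'rV[R]_n)
    (f g : 'rV[R]_n -> R) u :
  open U -> (forall v, U v -> f v = g v) -> U u -> {near u, f =1 g}.
Proof. by move=> oU fg Uu; apply: filterS fg _; exact: open_nbhs_nbhs. Qed.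

Lemma near_eq_continuous_at (R : realType) (T : topologicalType) (f g : T -> R) u :
  {near u, f =1 g} -> {for u, continuous f} -> {for u, continuous g}.
Proof.
move=> fg cf; apply: (cvg_trans (near_eq_cvg fg)).
by rewrite -(nbhs_singleton fg).
Qed.

Lemma Ck_on_ext (R : realType) (n k : nat) (U : set 'rV[R]_n) f g :
  open U -> (forall u, U u -> f u = g u) -> Ck_on k U f -> Ck_on k U g.
Proof.
move=> oU; elim: k f g => [|k IH] f g fg /= [cf hf].
  by split=> // u Uu; apply: near_eq_continuous_at (cf u Uu); exact: (open_near_eq oU fg Uu).
split=> [u Uu|i].
  by apply: near_eq_continuous_at (cf u Uu); exact: (open_near_eq oU fg Uu).
have [df hp] := hf i; split=> [u Uu|].
  by apply: near_eq_derivable (df u Uu); exact: (open_near_eq oU fg Uu).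
by apply: IH hp => u Uu; apply: near_eq_derive; exact: (open_near_eq oU fg Uu).
Qed.

Lemma Ck_on_cst (R : realType) (n k : nat) (U : set 'rV[R]_n) (a : R) :
  Ck_on k U (fun=> a).
Proof.
elim: k a => [|k IH] a /=; split=> //.
- by move=> u _; apply: cst_continuous.
- by move=> u _; apply: cst_continuous.
move=> i; split; first by move=> u _; exact: derivable_cst.
have -> : partial i (fun=> a) = (fun=> 0) :> ('rV[R]_n -> R).
  by apply/funext => u; exact: derive_cst.
exact: IH.
Qed.

Lemma is_derive_coord (R : realType) (m n : nat) (i : 'I_m) (j : 'I_n)
    (u v : 'M[R]_(m, n)) :
  is_derive u v (fun w : 'M[R]_(m, n) => w i j : R) (v i j).
Proof.
have dc : differentiable (fun w : 'M[R]_(m, n) => w i j) u.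
  exact: differentiable_coord.
split; first exact: diff_derivable.
rewrite /derive; apply: cvg_lim => //.
apply: (@cvg_trans _ (cst (v i j) @ (0 : R)^')).
  apply: near_eq_cvg; apply: filterS (nbhs_dnbhs_neq (0 : R)) => h h0.
  by rewrite /= !mxE addrK scalerA mulVf ?scale1r.
exact: cvg_cst.
Qed.

Lemma Ck_on_coord (R : realType) (n k : nat) (U : set 'rV[R]_n) (j : 'I_n) :
  Ck_on k U (fun u => u 0 j).
Proof.
case: k => [|k] /=; split=> //.
- by move=> u _; exact: coord_continuous.
- by move=> u _; exact: coord_continuous.
move=> i; split; first by move=> u _; exact/diff_derivable/differentiable_coord.
have -> : partial i (fun u : 'rV[R]_n => u 0 j) =
          (fun=> (delta_mx 0 i : 'rV[R]_n) 0 j).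
  by apply/funext => u; have [] := is_derive_coord 0 j u (delta_mx 0 i : 'rV[R]_n).
exact: Ck_on_cst.
Qed.

Lemma Ck_on_add (R : realType) (n k : nat) (U : set 'rV[R]_n) f g :
  open U -> Ck_on k U f -> Ck_on k U g -> Ck_on k U (fun u => f u + g u).
Proof.
move=> oU; elim: k f g => [|k IH] f g [cf hf] [cg hg]; split=> //.
- by move=> u Uu; exact: (cvgD (cf u Uu) (cg u Uu)).
- by move=> u Uu; exact: (cvgD (cf u Uu) (cg u Uu)).
- move=> i; have [df pf] := hf i; have [dg pg] := hg i; split=> [u Uu|].
    by apply: derivableD; [exact: df|exact: dg].
  apply: (Ck_on_ext oU _ (IH _ _ pf pg)) => u Uu.
  by rewrite /partial deriveD//; [exact: df|exact: dg].
Qed.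

Lemma Ck_on_mul (R : realType) (n k : nat) (U : set 'rV[R]_n) f g :
  open U -> Ck_on k U f -> Ck_on k U g -> Ck_on k U (fun u => f u * g u).
Proof.
move=> oU; elim: k f g => [|k IH] f g hf hg.
  by split=> // u Uu; exact: (cvgM (Ck_on_continuous hf Uu) (Ck_on_continuous hg Uu)).
have [f0 g0] := (Ck_onW hf, Ck_onW hg).
move: hf hg => [cf hf] [cg hg]; split=> //.
- by move=> u Uu; exact: (cvgM (cf u Uu) (cg u Uu)).
- move=> i; have [df pf] := hf i; have [dg pg] := hg i; split=> [u Uu|].
    by apply: derivableM; [exact: df|exact: dg].
  apply: (Ck_on_ext oU _ (Ck_on_add oU (IH _ _ f0 pg) (IH _ _ g0 pf))) => u Uu.
  by rewrite /partial deriveM//; [exact: df|exact: dg].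
Qed.

Lemma Ck_on_opp (R : realType) (n k : nat) (U : set 'rV[R]_n) f :
  open U -> Ck_on k U f -> Ck_on k U (fun u => - f u).
Proof.
move=> oU hf; apply: (Ck_on_ext oU _ (Ck_on_mul oU (Ck_on_cst k U (-1)) hf)).
by move=> u _; rewrite mulN1r.
Qed.

Lemma Ck_on_sub (R : realType) (n k : nat) (U : set 'rV[R]_n) f g :
  open U -> Ck_on k U f -> Ck_on k U g -> Ck_on k U (fun u => f u - g u).
Proof. by move=> oU hf hg; apply: Ck_on_add => //; exact: Ck_on_opp. Qed.

Lemma Ck_on_sum (R : realType) (n k : nat) (U : set 'rV[R]_n)
    (I : Type) (r : seq I) (P : pred I) (F : I -> 'rV[R]_n -> R) :
  open U -> (forall i, P i -> Ck_on k U (F i)) ->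
  Ck_on k U (fun u => \sum_(i <- r | P i) F i u).
Proof.
move=> oU hF; elim: r => [|i r IH].
  by apply: (Ck_on_ext oU _ (Ck_on_cst k U 0)) => u _; rewrite big_nil.
case Pi: (P i); last first.
  by apply: (Ck_on_ext oU _ IH) => u _; rewrite big_cons Pi.
apply: (Ck_on_ext oU _ (Ck_on_add oU (hF i Pi) IH)) => u _.
by rewrite big_cons Pi.
Qed.

Lemma Ck_on_prod (R : realType) (n k : nat) (U : set 'rV[R]_n)
    (I : Type) (r : seq I) (P : pred I) (F : I -> 'rV[R]_n -> R) :
  open U -> (forall i, P i -> Ck_on k U (F i)) ->
  Ck_on k U (fun u => \prod_(i <- r | P i) F i u).
Proof.
move=> oU hF; elim: r => [|i r IH].
  by apply: (Ck_on_ext oU _ (Ck_on_cst k U 1)) => u _; rewrite big_nil.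
case Pi: (P i); last first.
  by apply: (Ck_on_ext oU _ IH) => u _; rewrite big_cons Pi.
apply: (Ck_on_ext oU _ (Ck_on_mul oU (hF i Pi) IH)) => u _.
by rewrite big_cons Pi.
Qed.

Lemma Ck_on_inv (R : realType) (n k : nat) (U : set 'rV[R]_n) f :
  open U -> (forall u, U u -> f u != 0) ->
  Ck_on k U f -> Ck_on k U (fun u => (f u)^-1).
Proof.
move=> oU f0; elim: k => [|k IH] hf.
  split=> // u Uu; exact: (cvgV (f0 u Uu) (Ck_on_continuous hf Uu)).
have fk := Ck_onW hf.
split=> [u Uu|i].
  exact: (cvgV (f0 u Uu) (Ck_on_continuous hf Uu)).
have [_ /(_ i)[df pf]] := hf; split=> [u Uu|].
  by apply: derivableV; [exact: f0|exact: df].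
have iv2 := Ck_on_mul oU (IH fk) (IH fk).
apply: (Ck_on_ext oU _ (Ck_on_opp oU (Ck_on_mul oU iv2 pf))) => u Uu.
rewrite /partial deriveV//; [|exact: f0|exact: df].
by rewrite -exprVn expr2 scaleNr.
Qed.

(** Turns a directional derivative into an ordinary one, so that one-variable theorems apply along
    lines. *)
Lemma derive_line (R : realType) (V W : normedModType R) (f : V -> W) (u v : V) :
  'D_v f u = 'D_1 (fun s : R => f (s *: v + u)) (0 : R).
Proof.
rewrite /derive; set g1 := fun h => h^-1 *: _; set g2 := fun h => h^-1 *: _.
suff -> : g1 = g2 by [].
by rewrite funeqE /g1 /g2 => h /=; rewrite addr0 scale0r add0r [_%:A]mulr1.
Qed.

(** Asks for derivability of [f] along [v] alone, which is what [Ck_on] provides directly; it serves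
    the square root and the squared positive part. *)
Lemma is_derive_comp1 (R : realType) (V : normedModType R) (f : V -> R)
    (p : R -> R) (u v : V) (dp : R) :
  derivable f u v -> is_derive (f u) 1 p dp ->
  is_derive u v (fun w => p (f w)) (dp * 'D_v f u).
Proof.
move=> /derivable1P df hp.
set h := fun s : R => f (s *: v + u).
have hp' : is_derive (h 0) 1 p dp by rewrite /h scale0r add0r.
have dh : is_derive (0 : R) 1 h ('D_v f u) by split; [exact: df|rewrite [RHS]derive_line].
have [d1 d2] : is_derive (0 : R) 1 (p \o h) (dp * 'D_v f u).
  exact: is_derive1_comp.
by split; [exact/derivable1P|rewrite [LHS]derive_line].
Qed.

Lemma Ck_on_sqrt (R : realType) (n k : nat) (U : set 'rV[R]_n) f :
  open U -> (forall u, U u -> 0 < f u) ->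
  Ck_on k U f -> Ck_on k U (fun u => Num.sqrt (f u)).
Proof.
move=> oU f0; elim: k => [|k IH] hf.
  split=> // u Uu.
  by apply: continuous_comp; [exact: (Ck_on_continuous hf Uu)|exact: sqrt_continuous].
have fk := Ck_onW hf.
split=> [u Uu|i].
  by apply: continuous_comp; [exact: (Ck_on_continuous hf Uu)|exact: sqrt_continuous].
have [_ /(_ i)[df pf]] := hf.
have ds u : U u -> is_derive u (delta_mx 0 i : 'rV[R]_n)
    (fun w => Num.sqrt (f w)) ((2 * Num.sqrt (f u))^-1 * partial i f u).
  by move=> Uu; apply: is_derive_comp1; [exact: df|exact/is_derive1_sqrt/f0].
split=> [u /ds[]//|].
have s2 : Ck_on k U (fun u => (2 * Num.sqrt (f u))^-1).
  apply: Ck_on_inv => // [u Uu|]; last exact: (Ck_on_mul oU (Ck_on_cst k U 2) (IH fk)).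
  by rewrite mulf_neq0// gt_eqF// sqrtr_gt0 f0.
by apply: (Ck_on_ext oU _ (Ck_on_mul oU s2 pf)) => u /ds[].
Qed.

(** * The chain rule *)

(** The increment [a] may have either sign, hence the two cases at the end and the control of [c] by
    absolute value only. *)
Lemma MVT_line (R : realType) (V : normedModType R) (f : V -> R) (w v : V) (a : R) :
  (forall s, `|s| <= `|a| -> derivable f (s *: v + w) v) ->
  exists2 c, `|c| <= `|a| & f (a *: v + w) - f w = a * 'D_v f (c *: v + w).
Proof.
move=> df; pose h s := f (s *: v + w).
have dh s : `|s| <= `|a| -> is_derive (s : R) 1 h ('D_v f (s *: v + w)).
  move=> /df sa.
  have E : (fun r : R => f (r *: v + (s *: v + w))) = h \o shift s.
    by apply/funext => r; rewrite /h /= scalerDl addrA.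
  (* [derive_line] only speaks of the derivative at 0, so the base point is moved to [s v + w] and
     the parameter is shifted back afterwards. *)
  have : is_derive (0 : R) 1 (h \o shift s) ('D_v f (s *: v + w)).
    by split; [by rewrite -E; move/derivable1P: sa|rewrite [RHS]derive_line E].
  move=> hs; have -> : h = (h \o shift s) \o shift (- s).
    by apply/funext => r /=; rewrite subrK.
  have hs' : is_derive ((shift (- s) : R -> R) s) 1 (h \o shift s) ('D_v f (s *: v + w)).
    by rewrite /= subrr.
  rewrite -['D_v f _]mulr1.
  exact: (is_derive1_comp hs' (is_derive_shift _ _ _)).
have ch s : `|s| <= `|a| -> {for s, continuous h}.
  by move=> /dh [d1 _]; apply/differentiable_continuous/derivable1_diffP.
have h0 : h 0 = f w by rewrite /h scale0r add0r.
have [a0|/ltW a0] := leP 0 a.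
- have sub x : x \in `[0, a] -> `|x| <= `|a|.
    by rewrite in_itv/= => /andP[x0 xa]; rewrite !ger0_norm.
  have [||c cin] := @MVT_segment R h (fun s => 'D_v f (s *: v + w)) 0 a a0.
  + by move=> x /subset_itv_oo_cc/sub/dh.
  + by apply: continuous_in_subspaceT => x /set_mem/sub/ch.
  rewrite h0 subr0 mulrC => E; exists c => //.
  exact: sub.
- have sub x : x \in `[a, 0] -> `|x| <= `|a|.
    by rewrite in_itv/= => /andP[ax x0]; rewrite !ler0_norm// lerN2.
  have [||c cin] := @MVT_segment R h (fun s => 'D_v f (s *: v + w)) a 0 a0.
  + by move=> x /subset_itv_oo_cc/sub/dh.
  + by apply: continuous_in_subspaceT => x /set_mem/sub/ch.
  rewrite h0 sub0r mulrN => E; exists c; first exact: sub.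
  by rewrite mulrC -[RHS]opprK -E opprB.
Qed.

Lemma normr_coord (R : realType) (n : nat) (v : 'rV[R]_n) j : `|v 0 j| <= `|v|.
Proof.
rewrite [leRHS]/Num.Def.normr/= mx_normrE.
exact: (le_bigmax _ (fun ij : 'I_1 * 'I_n => `|v ij.1 ij.2|) (0, j)).
Qed.

Lemma row_norm_le (R : realType) (n : nat) (v : 'rV[R]_n) (e : R) :
  0 <= e -> (forall j, `|v 0 j| <= e) -> `|v| <= e.
Proof.
move=> e0 ve; rewrite [leLHS]/Num.Def.normr/= mx_normrE.
by apply/bigmax_le => // -[i j] _ /=; rewrite (ord1 i).
Qed.

(** The candidate differential, with [d] the vector of partial derivatives. It is given a linear
    structure so that uniqueness of the differential can be applied to it. *)
Definition dot_row (R : realType) (n : nat) (d : 'I_n -> R) (v : 'rV[R]_n) : R :=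
  \sum_(j < n) v 0 j * d j.

Lemma dot_row_is_linear (R : realType) (n : nat) (d : 'I_n -> R) :
  linear (dot_row d : 'rV[R]_n -> R).
Proof.
move=> a v w; rewrite /dot_row scaler_sumr -big_split/=.
by apply: eq_bigr => j _; rewrite !mxE mulrDl -mulrA.
Qed.

HB.instance Definition _ (R : realType) (n : nat) (d : 'I_n -> R) :=
  GRing.isLinear.Build R 'rV[R]_n R *:%R (dot_row d) (dot_row_is_linear d).

Lemma dot_row_continuous (R : realType) (n : nat) (d : 'I_n -> R) :
  continuous (dot_row d : 'rV[R]_n -> R).
Proof.
have h : Ck_on 0 setT (dot_row d : 'rV[R]_n -> R).
  apply: Ck_on_sum => [|j _]; first exact: openT.
  by apply: Ck_on_mul; [exact: openT|exact: Ck_on_coord|exact: Ck_on_cst].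
by move=> u; exact: (Ck_on_continuous h I).
Qed.

Definition row_trunc (R : realType) (n : nat) (k : nat) (v : 'rV[R]_n) : 'rV[R]_n :=
  \row_j (if (j < k)%N then v 0 j else 0).

Lemma row_truncS (R : realType) (n : nat) (k : 'I_n) (v : 'rV[R]_n) :
  row_trunc k.+1 v = v 0 k *: delta_mx 0 k + row_trunc k v.
Proof.
apply/rowP => j; rewrite !mxE /= ltnS leq_eqVlt.
have [->|jk] := eqVneq j k; first by rewrite eqxx ltnn/= mulr1 addr0.
by rewrite -val_eqE in jk; rewrite (negbTE jk)/= mulr0 add0r.
Qed.

(* The coordinates of the increment are switched on one at a time, with the
   mean value theorem at each step. *)
Lemma C1_little_o (R : realType) (n : nat) (U : set 'rV[R]_n) f u :
  open U -> Ck_on 1 U f -> U u ->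
  forall e : R, 0 < e -> \forall v \near (0 : 'rV[R]_n),
    `|f (v + u) - (f u + dot_row (fun j => partial j f u) v)| <= e * `|v|.
Proof.
move=> oU [_ hf] Uu e e0.
(* The [n] increments below add up to at most [n * (e / n.+1)] times [|v|]; taking [n.+1] keeps the
   denominator nonzero in dimension 0. *)
have [d d0 dP] : exists2 d : R, 0 < d & forall w : 'rV[R]_n, `|w| < d ->
    U (w + u) /\ forall j, `|partial j f (w + u) - partial j f u| <= e / n.+1%:R.
  have en : 0 < e / n.+1%:R by rewrite divr_gt0.
  have : \forall w \near u, U w /\
      forall j, `|partial j f w - partial j f u| <= e / n.+1%:R.
    apply: filterI; first exact: open_nbhs_nbhs.
    apply: (filter_forall (F := nbhs u)) => j; have [_ [cpj _]] := hf j.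
    have /cvgrPdist_le/(_ _ en) := cpj u Uu.
    by apply: filterS => w; rewrite distrC.
  move=> /nbhs_ballP[d /= d0 dP]; exists d => // w wd.
  by apply: dP; rewrite -ball_normE /= opprD addrCA subrr addr0 normrN.
apply: filterS (nbhs0_lt d0) => v vd.
have tv k : `|row_trunc k v| <= `|v|.
  apply: row_norm_le => // j; rewrite mxE; case: ifP => _; first exact: normr_coord.
  by rewrite normr0.
have step (k : 'I_n) : `|f (row_trunc k.+1 v + u) - f (row_trunc k v + u)
    - v 0 k * partial k f u| <= `|v| * (e / n.+1%:R).
  rewrite row_truncS -[_ + _ + u]addrA.
  (* The points met while coordinate [k] is switched on are bounded by [v] coordinate by coordinate,
     hence stay in the ball where the partial derivatives are controlled. *)
  have sd s : `|s| <= `|v 0 k| -> `|s *: delta_mx 0 k + row_trunc k v| < d.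
    move=> sv; apply: le_lt_trans vd; apply: row_norm_le => // j.
    rewrite !mxE /=; have [->|jk] := eqVneq j k.
      by rewrite ltnn mulr1 addr0 (le_trans sv)// normr_coord.
    rewrite mulr0 add0r; case: ifP => _; first exact: normr_coord.
    by rewrite normr0.
  have [s /sd|c cv ->] := @MVT_line R _ f (row_trunc k v + u)
      (delta_mx 0 k : 'rV[R]_n) (v 0 k).
    by move=> /dP[Us _]; rewrite addrA; have [+ _] := hf k; exact.
  rewrite -mulrBr normrM ler_pM// ?normr_coord// addrA.
  by have [_ /(_ k)] := dP _ (sd _ cv).
have T0 : row_trunc 0 v = 0 by apply/rowP => j; rewrite !mxE.
have Tn : row_trunc n v = v by apply/rowP => j; rewrite !mxE ltn_ord.
have -> : f (v + u) - (f u + dot_row (fun j => partial j f u) v) =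
    \sum_(k < n) (f (row_trunc k.+1 v + u) - f (row_trunc k v + u)
    - v 0 k * partial k f u).
  rewrite big_split/= sumrN opprD addrA; congr (_ - _).
  rewrite -(big_mkord xpredT (fun k => f (row_trunc k.+1 v + u) - f (row_trunc k v + u))).
  by rewrite telescope_sumr// T0 Tn add0r.
apply: (le_trans (ler_norm_sum _ _ _)).
apply: (le_trans (ler_sum _ (fun k _ => step k))).
rewrite sumr_const card_ord -mulrnAr mulrC ler_wpM2r//.
rewrite -mulr_natr -mulrA ler_piMr ?(ltW e0)// mulrC.
by rewrite ler_pdivrMr// mul1r ler_nat.
Qed.

Lemma C1_differentiable (R : realType) (n : nat) (U : set 'rV[R]_n) f u :
  open U -> Ck_on 1 U f -> U u ->
  differentiable f u /\
  forall v, 'd f u v = \sum_(j < n) v 0 j * partial j f u.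
Proof.
move=> oU hf Uu.
have lo : f \o shift u = cst (f u) + dot_row (fun j => partial j f u)
    +o_ (0 : 'rV[R]_n) id.
  by apply/eqaddoP => e e0; have := C1_little_o oU hf Uu e0.
have E := diff_unique (@dot_row_continuous _ _ _) lo.
split=> [|v]; last by rewrite E.
by apply/diff_locallyP; rewrite E; split => //; exact: dot_row_continuous.
Qed.

Lemma partial_comp (R : realType) (m n : nat) (U : set 'rV[R]_m)
    (V : set 'rV[R]_n) f (phi : 'rV[R]_m -> 'rV[R]_n) u i :
  open U -> open V -> U u -> V (phi u) -> Ck_on 1 V f ->
  (forall j, Ck_on 1 U (fun w => phi w 0 j)) ->
  derivable (f \o phi) u (delta_mx 0 i : 'rV[R]_m) /\
  partial i (f \o phi) u =
    \sum_(j < n) partial i (fun w => phi w 0 j) u * partial j f (phi u).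
Proof.
move=> oU oV Uu Vu hf hphi.
have dphi : differentiable phi u.
  (* The hypotheses speak of the coordinates of [phi]; differentiability of the vector-valued map is
     assembled from theirs along the standard basis. *)
  have -> : phi = \sum_(j < n) (fun w => phi w 0 j *: (delta_mx 0 j : 'rV[R]_n)).
    by apply/funext => w; rewrite fct_sumE [LHS]row_sum_delta.
  apply: differentiable_sum => j; apply: differentiableZl.
  by have [] := C1_differentiable oU (hphi j) Uu.
have [df Df] := C1_differentiable oV hf Vu.
have dc : differentiable (f \o phi) u by exact: differentiable_comp.
split; first exact: diff_derivable.
rewrite /partial deriveE// diff_comp//= Df; apply: eq_bigr => j _; congr (_ * _).
by rewrite -deriveE// derive_mx ?mxE//; exact: diff_derivable.
Qed.

Lemma row_continuous (R : realType) (T : topologicalType) (n : nat)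
    (phi : T -> 'rV[R]_n) u :
  (forall j, {for u, continuous (fun w => phi w 0 j)}) ->
  {for u, continuous phi}.
Proof.
move=> cphi; apply/cvgrPdist_le => e e0.
have : \forall w \near u, forall j, `|phi u 0 j - phi w 0 j| <= e.
  apply: (filter_forall (F := nbhs u)) => j.
  by have /cvgrPdist_le/(_ _ e0) := cphi j.
apply: filterS => w ew; apply: row_norm_le; first exact: ltW.
by move=> j; rewrite !mxE.
Qed.

Lemma Ck_on_comp (R : realType) (m n k : nat) (U : set 'rV[R]_m)
    (V : set 'rV[R]_n) f (phi : 'rV[R]_m -> 'rV[R]_n) :
  open U -> open V -> (forall u, U u -> V (phi u)) -> Ck_on k V f ->
  (forall j, Ck_on k U (fun w => phi w 0 j)) ->
  Ck_on k U (f \o phi).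
Proof.
move=> oU oV UV; elim: k f => [|k IH] f hf hphi.
  split=> // u Uu; apply: continuous_comp; last exact: (Ck_on_continuous hf (UV _ Uu)).
  by apply: row_continuous => j; exact: (Ck_on_continuous (hphi j) Uu).
have hf1 := Ck_on_leq (isT : (1 <= k.+1)%N) hf.
have hphi1 j := Ck_on_leq (isT : (1 <= k.+1)%N) (hphi j).
have c0 := Ck_on_continuous (IH _ (Ck_onW hf) (fun j => Ck_onW (hphi j))).
split=> [|i]; first by [].
split=> [u Uu|].
  by have [] := partial_comp i oU oV Uu (UV _ Uu) hf1 hphi1.
have : Ck_on k U (fun u => \sum_(j < n) partial i (fun w => phi w 0 j) u *
    (partial j f \o phi) u).
  apply: Ck_on_sum => // j _; apply: Ck_on_mul => //.
    by have [_ /(_ i)[]] := hphi j.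
  apply: IH; first by have [_ /(_ j)[]] := hf.
  by move=> l; exact: Ck_onW.
apply: Ck_on_ext => // u Uu.
by have [_ ->] := partial_comp i oU oV Uu (UV _ Uu) hf1 hphi1.
Qed.

(** * Compactly supported functions and the Lebesgue measure *)

(** The norm of a row is the sup norm, so the bound passes to single coordinates and to slices with
    the same [K]. *)
Definition csupp (R : realType) (n : nat) (K : R) (f : 'rV[R]_n -> R) : Prop :=
  forall u, K < `|u| -> f u = 0.

Lemma csupp_unif (R : realType) (n : nat) (K : R) (f : 'rV[R]_n -> R) :
  continuous f -> csupp K f -> forall e : R, 0 < e ->
  exists2 d : R, 0 < d & forall u h, `|h| < d -> `|f (u + h) - f u| <= e.
Proof.
move=> cf sf e e0.
(* The margin 1 lets increments of norm less than 1 be handled outside this ball: there both [u] and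
   [u + h] have norm above [K], where [f] vanishes. *)
have cB : compact [set u : 'rV[R]_n | `|u| <= K + 1].
  apply: bounded_closed_compact.
    by exists (K + 1); split; [exact: num_real|move=> M KM u /= uK; exact: (le_trans uK (ltW KM))].
  apply: (@preimage_closed _ _ (fun u : 'rV[R]_n => `|u|) [set x | x <= K + 1]); last exact: closed_le.
  by move=> u _; exact: norm_continuous.
have : \forall h \near (0 : 'rV[R]_n), [set u : 'rV[R]_n | `|u| <= K + 1] `<=`
    (fun u => `|f (u + h) - f u| <= e).
  apply: ((compact_near_coveringP _).1 cB _ (nbhs (0 : 'rV[R]_n))
    (fun h u => `|f (u + h) - f u| <= e)) => u _.
  have cu : (fun p : 'rV[R]_n * 'rV[R]_n => f (p.1 + p.2) - f p.1) @ (u, 0 : 'rV[R]_n) --> f (u + 0) - f u.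
    apply: cvgB.
      apply: (@cvg_comp _ _ _ (fun p : 'rV[R]_n * 'rV[R]_n => p.1 + p.2) f _ (nbhs (u + 0))).
        by apply: cvgD; [exact: cvg_fst|exact: cvg_snd].
      exact: cf.
    by apply: (@cvg_comp _ _ _ fst f _ (nbhs u)); [exact: cvg_fst|exact: cf].
  rewrite addr0 subrr in cu.
  move/cvgrPdist_le : cu => /(_ _ e0).
  by apply: filterS => -[a b] /=; rewrite sub0r normrN.
move=> /nbhs_ballP[d /= d0 dP]; exists (Num.min 1 d); first by rewrite lt_min ltr01 d0.
move=> u h; rewrite lt_min => /andP[h1 hd].
have [uK|uK] := leP `|u| (K + 1).
  by apply: dP => //; rewrite -ball_normE /= sub0r normrN.
rewrite !sf ?subrr ?normr0 ?ltW//.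
  by rewrite (le_lt_trans _ uK)// lerDl.
have : `|u| <= `|u + h| + `|h| by rewrite -[u in leLHS](addrK h) (le_trans (ler_normB _ _)).
by lra.
Qed.

Lemma csupp_integrable (R : realType) (K : R) (G : R -> R) :
  continuous G -> (forall t, K < `|t| -> G t = 0) ->
  (@lebesgue_measure R).-integrable setT (EFin \o G).
Proof.
move=> cG sG.
have E : EFin \o G = (EFin \o G) \_ `[-K, K].
  apply/funext => t; rewrite patchE; case: ifPn => //.
  by rewrite notin_setE /= in_itv/= -ler_norml => /negP; rewrite -ltNge => /sG ->.
rewrite E; apply: (integrable_mkcond _ _).1; first exact: measurable_itv.
apply: continuous_compact_integrable; first exact: segment_compact.
exact: continuous_subspaceT.
Qed.

Lemma Rintegral_csupp_itv (R : realType) (K : R) (G : R -> R) :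
  (forall t, K < `|t| -> G t = 0) ->
  \int[@lebesgue_measure R]_t G t = \int[@lebesgue_measure R]_(t in `[-K, K]) G t.
Proof.
move=> sG; rewrite [RHS]Rintegral_mkcond; apply: eq_Rintegral => t _.
rewrite patchE; case: ifPn => //.
by rewrite notin_setE /= in_itv/= -ler_norml => /negP; rewrite -ltNge => /sG ->.
Qed.

Lemma segment_measure (R : realType) (a b : R) : a <= b ->
  @lebesgue_measure R `[a, b]%classic = (b - a)%:E.
Proof.
move=> ab; have := @lebesgue_measure_itv R `[a, b].
rewrite /= lte_fin => ->; case: ifPn => [_|]; first by rewrite EFinB.
by rewrite -leNgt => ba; rewrite (le_anti (introT andP (conj ab ba))) subrr.
Qed.

Lemma Rintegral_csupp_bound (R : realType) (K e : R) (G : R -> R) :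
  0 <= K -> 0 <= e -> continuous G -> (forall t, K < `|t| -> G t = 0) ->
  (forall t, `|G t| <= e) ->
  `|\int[@lebesgue_measure R]_t G t| <= e * (2 * K).
Proof.
move=> K0 e0 cG sG Ge.
have intK (H : R -> R) : continuous H ->
    (@lebesgue_measure R).-integrable `[-K, K] (EFin \o H).
  move=> cH; apply: continuous_compact_integrable; first exact: segment_compact.
  exact: continuous_subspaceT.
rewrite (Rintegral_csupp_itv sG).
apply: le_trans (le_normr_Rintegral _ _) _ => //; first exact: intK.
apply: (@le_trans _ _ (\int[@lebesgue_measure R]_(t in `[-K, K]) e)).
  apply: le_Rintegral => //.
  - apply: intK => t; apply: (@continuous_comp _ _ _ G (fun x => `|x|)); first exact: cG.
    exact: norm_continuous.
  - by apply: intK => t; exact: cst_continuous.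
rewrite Rintegral_cst; last exact: measurable_itv.
rewrite ler_wpM2l// [X in fine X]segment_measure/=; first by lra.
by lra.
Qed.

Lemma Rintegral_gt0 (R : realType) (K t0 : R) (G : R -> R) :
  continuous G -> (forall t, K < `|t| -> G t = 0) ->
  (forall t, 0 <= G t) -> 0 < G t0 ->
  0 < \int[@lebesgue_measure R]_t G t.
Proof.
move=> cG sG G0 Gt0.
have c0 : 0 < G t0 / 2 by rewrite divr_gt0.
have /cvgrPdist_lt/(_ _ c0)/nbhs_ballP[d /= d0 dP] := cG t0.
(* Half the radius, so that the closed interval [I] lies in the open ball on which [G] exceeds half
   of [G t0]. *)
have d20 : 0 < d / 2 by rewrite divr_gt0.
pose I : set R := `[t0 - d / 2, t0 + d / 2]%classic.
apply: (@lt_le_trans _ _ (\int[@lebesgue_measure R]_(t in I) (G t0 / 2))).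
  rewrite Rintegral_cst; last exact: measurable_itv.
  rewrite mulr_gt0// [X in fine X]segment_measure/=; first by lra.
  by lra.
rewrite Rintegral_mkcond; apply: le_Rintegral => //.
- rewrite -restrict_EFin; apply: (integrable_mkcond _ _).1; first exact: measurable_itv.
  apply: continuous_compact_integrable; first exact: segment_compact.
  by apply: continuous_subspaceT => t; exact: cst_continuous.
- exact: csupp_integrable sG.
move=> t _; rewrite patchE; case: ifPn => // /set_mem.
rewrite /I /= in_itv/= => /andP[t1 t2].
have : `|G t0 - G t| < G t0 / 2.
  by apply: dP; rewrite -ball_normE /= ltr_distlC; apply/andP; split; lra.
by rewrite ltr_distlC => /andP[]; lra.
Qed.

(** Lebesgue measure is determined by its values on half-open intervals, where a shift preserves the
    length. *)
Lemma lebesgue_measure_shift (R : realType) (a : R) (A : set R) : measurable A ->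
  pushforward (@lebesgue_measure R) (shift a : _ -> measurableTypeR R) A =
  lebesgue_measure A.
Proof.
have ms : measurable_fun setT (shift a : measurableTypeR R -> measurableTypeR R).
  apply: continuous_measurable_fun => t.
  by apply: cvgD; [exact: cvg_id|exact: cst_continuous].
move=> mA; apply/esym/lebesgue_measure_unique => //= _ [[b c]] _ <-.
rewrite /pushforward.
have -> : shift a @^-1` `]b, c] = `]b - a, c - a]%classic.
  by apply/seteqP; split => x /=; rewrite !in_itv/= ltrBlDr lerBrDr.
rewrite !lebesgue_measure_itv/= !lte_fin ltrD2r; case: ifP => // _.
by rewrite -!EFinB; congr EFin; ring.
Qed.

Lemma Rintegral_shift (R : realType) (K a : R) (G : R -> R) :
  continuous G -> (forall t, K < `|t| -> G t = 0) ->
  \int[@lebesgue_measure R]_t G (t + a) = \int[@lebesgue_measure R]_t G t.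
Proof.
move=> cG sG.
have ms : measurable_fun setT (shift a : measurableTypeR R -> measurableTypeR R).
  apply: continuous_measurable_fun => t.
  by apply: cvgD; [exact: cvg_id|exact: cst_continuous].
have cGa : continuous (fun t => G (t + a)).
  move=> t; apply: (@continuous_comp _ _ _ (fun t => t + a) G); last exact: cG.
  by apply: cvgD; [exact: cvg_id|exact: cst_continuous].
have sGa t : K + `|a| < `|t| -> G (t + a) = 0.
  move=> tK; apply: sG; have := ler_normB (t + a) a; rewrite addrK; lra.
have mG : measurable_fun setT (EFin \o G : measurableTypeR R -> \bar R).
  by apply/measurable_EFinP; exact: continuous_measurable_fun.
rewrite /Rintegral; congr fine.
have iG : (@lebesgue_measure R).-integrable (shift a @^-1` setT)
    ((EFin \o G) \o (shift a : measurableTypeR R -> measurableTypeR R)).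
  exact: csupp_integrable sGa.
have := integral_pushforward ms mG iG measurableT; rewrite preimage_setT => E.
rewrite -[LHS]E.
by apply: eq_measure_integral => /= A mA _; exact: lebesgue_measure_shift.
Qed.

(** * The iterated integral *)

Lemma continuous_lin (R : realType) (T : topologicalType) (a : R) (f g : T -> R) :
  continuous f -> continuous g -> continuous (fun u => a * f u + g u).
Proof.
move=> cf cg u; have ca : {for u, continuous (fun=> a : R)} by exact: cst_continuous.
exact: (cvgD (cvgM ca (cf u)) (cg u)).
Qed.

(** The row built in [integral_rV], retyped with [n.+1] columns so that its coordinates can be
    separated by [unliftP ord0]. *)
Definition consv (R : realType) (n : nat) (t : R) (v : 'rV[R]_n) : 'rV[R]_n.+1 :=
  (row_mx (const_mx t : 'rV[R]_1) v : 'rV[R]_(1 + n)).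

Lemma consvEl (R : realType) (n : nat) (t : R) (v : 'rV[R]_n) :
  consv t v 0 ord0 = t.
Proof.
have -> : ord0 = lshift n (0 : 'I_1) :> 'I_(1 + n) by exact: val_inj.
by apply: etrans (row_mxEl _ _ _ _) _; rewrite mxE.
Qed.

Lemma consvEr (R : realType) (n : nat) (t : R) (v : 'rV[R]_n) k :
  consv t v 0 (lift ord0 k) = v 0 k.
Proof.
have -> : lift ord0 k = rshift 1 k :> 'I_(1 + n) by exact: val_inj.
exact: (row_mxEr _ _ _ _).
Qed.

Lemma consvD (R : realType) (n : nat) (s t : R) (v w : 'rV[R]_n) :
  consv s v + consv t w = consv (s + t) (v + w).
Proof.
apply/rowP => j; rewrite [LHS]mxE.
by case: (unliftP ord0 j) => [k ->|->]; rewrite ?consvEl// !consvEr mxE.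
Qed.

Definition slice (R : realType) (n : nat) (f : 'rV[R]_n.+1 -> R) (t : R)
    (v : 'rV[R]_n) : R := f (consv t v).

Lemma integral_rVS (R : realType) (n : nat) (f : 'rV[R]_n.+1 -> R) :
  integral_rV f = \int[@lebesgue_measure R]_t integral_rV (slice f t).
Proof. by []. Qed.

Lemma normr_consvl (R : realType) (n : nat) (t : R) (v : 'rV[R]_n) :
  `|t| <= `|consv t v|.
Proof. by rewrite -{1}(consvEl t v) normr_coord. Qed.

Lemma normr_consvr (R : realType) (n : nat) (t : R) (v : 'rV[R]_n) :
  `|v| <= `|consv t v|.
Proof. by apply: row_norm_le => // j; rewrite -(consvEr t v) normr_coord. Qed.

Lemma consv_continuous (R : realType) (n : nat) (t : R) :
  continuous (@consv R n t).
Proof.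
move=> v; apply: row_continuous => j; case: (unliftP ord0 j) => [k ->|->]; last first.
  have -> : (fun w : 'rV[R]_n => consv t w 0 ord0) = fun=> t.
    by apply/funext => w; rewrite consvEl.
  exact: cst_continuous.
have -> : (fun w : 'rV[R]_n => consv t w 0 (lift ord0 k)) = fun w => w 0 k.
  by apply/funext => w; rewrite consvEr.
exact: coord_continuous.
Qed.

Lemma slice_continuous (R : realType) (n : nat) (f : 'rV[R]_n.+1 -> R) t :
  continuous f -> continuous (slice f t).
Proof.
move=> cf v; apply: (@continuous_comp _ _ _ (consv t) f); last exact: cf.
exact: consv_continuous.
Qed.

Lemma slice_csupp (R : realType) (n : nat) (f : 'rV[R]_n.+1 -> R) K t :
  csupp K f -> csupp K (slice f t).
Proof.
by move=> sf v vK; apply: sf; exact: (lt_le_trans vK (normr_consvr _ _)).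
Qed.

Lemma slice_csupp_l (R : realType) (n : nat) (f : 'rV[R]_n.+1 -> R) K t v :
  csupp K f -> K < `|t| -> slice f t v = 0.
Proof. by move=> sf tK; apply: sf; exact: (lt_le_trans tK (normr_consvl _ _)). Qed.

(** The two properties travel together in the induction on [n]: linearity in dimension [n.+1] needs
    an integrable outer integrand, whose continuity uses both linearity and the bound in dimension
    [n]. The factor is the volume of the sup ball of radius [K]. *)
Definition linear_bounded (R : realType) (n : nat) (K : R) : Prop :=
  (forall (a : R) (f g : 'rV[R]_n -> R),
    continuous f -> csupp K f -> continuous g -> csupp K g ->
    integral_rV (fun u => a * f u + g u) = a * integral_rV f + integral_rV g) /\
  (forall (e : R) (f : 'rV[R]_n -> R), 0 <= e ->
    continuous f -> csupp K f -> (forall u, `|f u| <= e) ->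
    `|integral_rV f| <= e * (2 * K) ^+ n).

Lemma slice_integral (R : realType) (n : nat) (K : R) (f : 'rV[R]_n.+1 -> R) :
  0 <= K -> linear_bounded n K -> continuous f -> csupp K f ->
  continuous (fun t : R => integral_rV (slice f t)) /\
  (forall t, K < `|t| -> integral_rV (slice f t) = 0).
Proof.
move=> K0 [IHl IHb] cf sf; split=> t.
  apply/cvgrPdist_le => e e0.
  (* The volume of the ball can be 0, as for [K = 0]; adding 1 makes the division legitimate. *)
  have C0 : 0 < (2 * K) ^+ n + 1 by rewrite ltr_wpDl// exprn_ge0// mulr_ge0.
  have [d d0 dP] := csupp_unif cf sf (divr_gt0 e0 C0).
  apply: filterS (nbhsx_ballx t d d0) => s; rewrite /ball/= => st.
  have -> : integral_rV (slice f t) - integral_rV (slice f s) =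
      integral_rV (fun v => - 1 * slice f s v + slice f t v).
    rewrite IHl; [by rewrite mulN1r addrC|exact: slice_continuous|
      exact: slice_csupp|exact: slice_continuous|exact: slice_csupp].
  apply: (@le_trans _ _ (e / ((2 * K) ^+ n + 1) * (2 * K) ^+ n)); last first.
    rewrite mulrAC -mulrA ler_piMr ?(ltW e0)// ler_pdivrMr// mul1r.
    by rewrite lerDl.
  apply: IHb.
  - by rewrite ltW// divr_gt0.
  - by apply: continuous_lin; exact: slice_continuous.
  - by move=> v vK; rewrite !(slice_csupp _ sf)// mulr0 addr0.
  move=> v; rewrite mulN1r addrC.
  have -> : slice f t v = f (consv s v + consv (t - s) 0).
    by rewrite consvD addr0 addrC subrK.
  apply: dP; apply: le_lt_trans st; apply: row_norm_le => // j.
  by case: (unliftP ord0 j) => [k ->|->]; rewrite ?consvEl// consvEr mxE normr0.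
(* The whole slice vanishes, so the bound is applied with constant 0. *)
move=> tK; apply/eqP; rewrite -normr_le0 -[leRHS](mul0r ((2 * K) ^+ n)).
apply: IHb => //; [exact: slice_continuous|exact: slice_csupp|].
by move=> u; rewrite (slice_csupp_l _ sf) ?normr0.
Qed.

Lemma integral_rV_linear_bound (R : realType) (n : nat) (K : R) : 0 <= K ->
  linear_bounded n K.
Proof.
move=> K0; elim: n => [|n IH].
  split=> // e f _ _ _ fe; rewrite expr0 mulr1; exact: fe.
have Gc (f : 'rV[R]_n.+1 -> R) (cf : continuous f) (sf : csupp K f) :=
  (slice_integral K0 IH cf sf).1.
have G0 (f : 'rV[R]_n.+1 -> R) t (cf : continuous f) (sf : csupp K f) :=
  (slice_integral K0 IH cf sf).2 t.
have [IHl IHb] := IH.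
split=> [a f g cf sf cg sg|e f e0 cf sf fe].
- have iG (h : 'rV[R]_n.+1 -> R) : continuous h -> csupp K h ->
      (@lebesgue_measure R).-integrable setT (EFin \o (fun t : R => integral_rV (slice h t))).
    move=> ch sh; exact: (csupp_integrable (Gc _ ch sh) (fun t => G0 h t ch sh)).
  rewrite !integral_rVS -RintegralZl//; last exact: iG.
  rewrite -RintegralD//; [|exact/(integrableZl _ a (iG f cf sf))|exact: iG].
  apply: eq_Rintegral => t _; rewrite -IHl//;
    [exact: slice_continuous|exact: slice_csupp|exact: slice_continuous|
     exact: slice_csupp].
- rewrite integral_rVS exprSr mulrA; apply: Rintegral_csupp_bound => //.
  + by rewrite mulr_ge0// exprn_ge0// mulr_ge0.
  + exact: Gc.
  + by move=> t; exact: G0.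
  by move=> t; apply: IHb => //; [exact: slice_continuous|exact: slice_csupp|move=> v; exact: fe].
Qed.

Lemma csupp_leq (R : realType) (n : nat) (K L : R) (f : 'rV[R]_n -> R) :
  K <= L -> csupp K f -> csupp L f.
Proof. by move=> KL sf u Lu; apply: sf; exact: le_lt_trans Lu. Qed.

(** The class on which the iterated integral is used. The radius is existential because sums and
    translates enlarge it. *)
Definition cc (R : realType) (n : nat) (f : 'rV[R]_n -> R) : Prop :=
  continuous f /\ exists K : R, csupp K f.

Lemma cc_common (R : realType) (n : nat) (f g : 'rV[R]_n -> R) :
  cc f -> cc g -> exists2 K : R, 0 <= K & csupp K f /\ csupp K g.
Proof.
move=> [_ [K sf]] [_ [L sg]]; exists (`|K| + `|L|); first by rewrite addr_ge0.
split; [apply: csupp_leq sf|apply: csupp_leq sg].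
  by rewrite (le_trans (ler_norm K))// lerDl.
by rewrite (le_trans (ler_norm L))// lerDr.
Qed.

Lemma cc_lin (R : realType) (n : nat) (a : R) (f g : 'rV[R]_n -> R) :
  cc f -> cc g -> cc (fun u => a * f u + g u).
Proof.
move=> hf hg; have [K K0 [sf sg]] := cc_common hf hg.
split; first by apply: continuous_lin; [exact: hf.1|exact: hg.1].
by exists K => u uK; rewrite sf// sg// mulr0 addr0.
Qed.

Lemma cc0 (R : realType) (n : nat) : cc (fun _ : 'rV[R]_n => 0 : R).
Proof. by split; [exact: cst_continuous|exists 0]. Qed.

Lemma integral_rV_lin (R : realType) (n : nat) (a : R) (f g : 'rV[R]_n -> R) :
  cc f -> cc g ->
  integral_rV (fun u => a * f u + g u) = a * integral_rV f + integral_rV g.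
Proof.
move=> hf hg; have [K K0 [sf sg]] := cc_common hf hg.
by apply: (integral_rV_linear_bound n K0).1 => //; [exact: hf.1|exact: hg.1].
Qed.

Lemma integral_rV0 (R : realType) (n : nat) :
  integral_rV (fun _ : 'rV[R]_n => 0 : R) = 0.
Proof.
apply/eqP; rewrite -normr_le0 -[leRHS](mul0r ((2 * (0 : R)) ^+ n)).
apply: (integral_rV_linear_bound n (lexx (0 : R))).2 => //.
  exact: cst_continuous.
by move=> u; rewrite normr0.
Qed.

Lemma cc_sum (R : realType) (n : nat) (I : Type) (r : seq I) (F : I -> 'rV[R]_n -> R) :
  (forall i, cc (F i)) ->
  cc (fun u => \sum_(i <- r) F i u) /\
  integral_rV (fun u => \sum_(i <- r) F i u) = \sum_(i <- r) integral_rV (F i).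
Proof.
move=> hF; elim: r => [|i r [IH1 IH2]].
  have -> : (fun u : 'rV[R]_n => \sum_(i <- [::]) F i u) = fun=> 0.
    by apply/funext => u; rewrite big_nil.
  by rewrite big_nil integral_rV0; split=> //; exact: cc0.
have -> : (fun u => \sum_(j <- i :: r) F j u) =
    fun u => 1 * F i u + \sum_(j <- r) F j u.
  by apply/funext => u; rewrite big_cons mul1r.
split; first exact: cc_lin.
by rewrite integral_rV_lin// IH2 big_cons mul1r.
Qed.

Lemma cc_slice (R : realType) (n : nat) (f : 'rV[R]_n.+1 -> R) (K : R) : 0 <= K ->
  continuous f -> csupp K f ->
  continuous (fun t : R => integral_rV (slice f t)) /\
  (forall t, K < `|t| -> integral_rV (slice f t) = 0).
Proof.
move=> K0; exact: slice_integral (integral_rV_linear_bound n K0).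
Qed.

Lemma continuous_translate (R : realType) (n : nat) (a : 'rV[R]_n) (f : 'rV[R]_n -> R) :
  continuous f -> continuous (fun u : 'rV[R]_n => f (u + a)).
Proof.
move=> cf u; apply: (@continuous_comp _ _ _ (fun u : 'rV[R]_n => u + a) f); last exact: cf.
have ca : {for u, continuous (fun=> a)} by exact: cst_continuous.
exact: (cvgD cvg_id ca).
Qed.

Lemma csupp_translate (R : realType) (n : nat) (a : 'rV[R]_n) (K : R) (f : 'rV[R]_n -> R) :
  csupp K f -> csupp (K + `|a|) (fun u : 'rV[R]_n => f (u + a)).
Proof.
move=> sf u uK; apply: sf; have := ler_normB (u + a) a; rewrite addrK; lra.
Qed.

(** A shift along an axis touches exactly one of the nested integrals: the outermost one, settled by
    the one-dimensional case, or one inside the slices, settled by induction. *)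
Lemma integral_rV_translate (R : realType) (n : nat) (i : 'I_n) (a : R)
    (f : 'rV[R]_n -> R) :
  cc f -> integral_rV (fun u : 'rV[R]_n => f (u + a *: delta_mx 0 i)) = integral_rV f.
Proof.
elim: n i f => [[]//|n IH] i f hf.
have [cf _] := hf; have [K K0 [sf _]] := cc_common hf hf.
rewrite !integral_rVS; case: (unliftP ord0 i) => [k ->|->].
  apply: eq_Rintegral => t _.
  rewrite -[RHS](IH k); last by split; [exact: (slice_continuous cf)|exists K; exact: slice_csupp sf].
  congr integral_rV; apply/funext => v; rewrite /slice; congr f.
  apply/rowP => j; rewrite [LHS]mxE [X in _ + X]mxE [X in _ * X]mxE.
  case: (unliftP ord0 j) => [l ->|->].
    by rewrite !consvEr !mxE (inj_eq (@lift_inj _ _)).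
  by rewrite !consvEl (negbTE (neq_lift _ _)) andbF mulr0 addr0.
have [cG sG] := cc_slice K0 cf sf.
rewrite -[RHS](Rintegral_shift a cG sG); apply: eq_Rintegral => t _.
congr integral_rV; apply/funext => v; rewrite /slice; congr f.
apply/rowP => j; rewrite [LHS]mxE [X in _ + X]mxE [X in _ * X]mxE.
case: (unliftP ord0 j) => [l ->|->].
  by rewrite !consvEr eq_sym (negbTE (neq_lift _ _)) andbF mulr0 addr0.
by rewrite !consvEl eqxx mulr1.
Qed.

Lemma csupp_near0 (R : realType) (n : nat) (K : R) (f : 'rV[R]_n -> R) u :
  csupp K f -> K < `|u| -> {near u, f =1 fun=> 0}.
Proof.
move=> sf uK; have : \forall v \near u, K < `|v|.
  have := @norm_continuous _ _ u; move/cvgrPdist_lt => /(_ (`|u| - K)).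
  rewrite subr_gt0 => /(_ uK); apply: filterS => v; rewrite ltr_distlC => /andP[]; lra.
by apply: filterS => v; exact: sf.
Qed.

(* The difference quotients of [psi] converge uniformly to its partial
   derivative, and their integrals vanish by invariance under translations. *)
Lemma integral_rV_partial (R : realType) (n : nat) (K : R) (i : 'I_n)
    (psi : 'rV[R]_n -> R) :
  Ck_on 1 setT psi -> csupp K psi ->
  cc (partial i psi) /\ integral_rV (partial i psi) = 0.
Proof.
move=> hpsi spsi.
have cpsi : continuous psi by move=> u; exact: (Ck_on_continuous hpsi).
have [_ /(_ i)[dpsi [cp _]]] := hpsi.
have {}cp : continuous (partial i psi) by move=> u; exact: cp.
have sp : csupp K (partial i psi).
  by move=> u uK; rewrite /partial (near_eq_derive _ (csupp_near0 spsi uK)) derive_cst.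
have ccp : cc (partial i psi) by split=> //; exists K.
split=> //.
(* A common radius for [psi] and its translate, whose shift has norm at most 1 because [h <= 1] and
   [|ei| <= 1]. *)
pose L := `|K| + 1; have L0 : 0 <= L by rewrite addr_ge0.
pose C := (2 * L) ^+ n; have C0 : 0 <= C by rewrite exprn_ge0// mulr_ge0.
apply/eqP; rewrite -normr_le0; apply/ler_addgt0Pl => e e0; rewrite addr0.
have C1 : 0 < C + 1 by rewrite ltr_wpDl.
have [d d0 dP] := csupp_unif cp sp (divr_gt0 e0 C1).
pose h := Num.min 1 (d / 2).
have h0 : 0 < h by rewrite lt_min ltr01 divr_gt0.
have h1 : h <= 1 by rewrite ge_min lexx.
have hd : h < d by rewrite gt_min; apply/orP; right; rewrite ltr_pdivrMr// ltr_pMr// ltr1n.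
pose ei : 'rV[R]_n := delta_mx 0 i.
pose T (u : 'rV[R]_n) := psi (u + h *: ei).
have ei1 : `|ei| <= 1.
  by apply: row_norm_le => // j; rewrite mxE/=; case: (_ == _); rewrite ?normr1 ?normr0.
have ccpsi : cc psi by split=> //; exists K.
have ccT : cc T.
  split; first exact: continuous_translate.
  by exists (K + `|h *: ei|); exact: csupp_translate.
pose Q u := h^-1 * T u + (- h^-1) * psi u.
have EQ : Q = fun u => h^-1 * T u + (- h^-1 * psi u + 0).
  by apply/funext => u; rewrite addr0.
have ccQ0 : cc (fun u => - h^-1 * psi u + 0) by apply: cc_lin => //; exact: cc0.
have ccQ : cc Q by rewrite EQ; exact: cc_lin.
have IQ : integral_rV Q = 0.
  rewrite EQ !integral_rV_lin//; last exact: cc0.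
  by rewrite integral_rV0 integral_rV_translate// addr0 mulNr subrr.
have -> : integral_rV (partial i psi) =
    integral_rV (fun u => - 1 * Q u + partial i psi u).
  by rewrite integral_rV_lin// IQ mulr0 add0r.
apply: (@le_trans _ _ (e / (C + 1) * C)); last first.
  by rewrite mulrAC -mulrA ler_piMr ?(ltW e0)// ler_pdivrMr// mul1r lerDl.
apply: (integral_rV_linear_bound n L0).2.
- by rewrite ltW// divr_gt0.
- by have [] := cc_lin (-1) ccQ ccp.
- move=> u uL; have uK : K < `|u|.
    by apply: le_lt_trans uL; rewrite (le_trans (ler_norm K))// lerDl.
  rewrite sp// /Q spsi// /T spsi ?mulr0 ?addr0 ?mulr0//.
  have := ler_normB (u + h *: ei) (h *: ei); rewrite addrK normrZ (gtr0_norm h0).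
  have : h * `|ei| <= 1 by rewrite -[leRHS]mulr1 ler_pM// ltW.
  move: uL; rewrite /L; have := ler_norm K; lra.
(* By the mean value theorem the quotient [Q u] is the partial derivative at a point at distance at
   most [h < d] from [u], so uniform continuity bounds the error independently of [u]. *)
move=> u; have [s _|c ch E] := @MVT_line R _ psi u ei h.
  exact: dpsi.
have -> : - 1 * Q u + partial i psi u =
    partial i psi u - partial i psi (u + c *: ei).
  rewrite addrC mulN1r; congr (_ - _).
  rewrite /Q mulNr -mulrBr /T [u + h *: ei]addrC E mulrA mulVf ?gt_eqF// mul1r.
  by rewrite [c *: ei + u]addrC.
rewrite distrC; apply: dP; rewrite normrZ.
apply: le_lt_trans hd; rewrite -[leRHS]mulr1 ler_pM//.
by rewrite (le_trans ch)// gtr0_norm.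
Qed.

Lemma integral_rV_ge0 (R : realType) (n : nat) (f : 'rV[R]_n -> R) :
  (forall u, 0 <= f u) -> 0 <= integral_rV f.
Proof.
elim: n f => [|n IH] f f0; first exact: f0.
by rewrite integral_rVS; apply: Rintegral_ge0 => t _; apply: IH => v; exact: f0.
Qed.

Lemma integral_rV_gt0 (R : realType) (n : nat) (f : 'rV[R]_n -> R) u0 :
  cc f -> (forall u, 0 <= f u) -> 0 < f u0 -> 0 < integral_rV f.
Proof.
elim: n f u0 => [|n IH] f u0 hf f0 fu0; first by rewrite /= (_ : 0 = u0)//; apply/rowP => -[].
have [cf _] := hf; have [K K0 [sf _]] := cc_common hf hf.
have [cG sG] := cc_slice K0 cf sf.
rewrite integral_rVS; apply: (Rintegral_gt0 (t0 := u0 0 ord0) cG sG).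
  by move=> t; apply: integral_rV_ge0 => v; exact: f0.
(* The outer integrand is tested at the first coordinate of [u0], and the slice there at the
   remaining ones. *)
apply: (IH _ (\row_j u0 0 (lift ord0 j))).
- by split; [exact: (slice_continuous cf)|exists K; exact: slice_csupp sf].
- by move=> v; exact: f0.
rewrite /slice (_ : consv _ _ = u0)//; apply/rowP => j.
by case: (unliftP ord0 j) => [k ->|->]; rewrite ?consvEl// consvEr mxE.
Qed.

(** * Functions on a manifold *)

Section Manifold.
Context (R : realType) (n : nat) (M : smoothManifold R n).
Implicit Types (c d : chart M) (f g : M -> R) (x : M).

(** Finite classes are needed besides [smooth], as the bump functions built below are only shown to
    be of class C^1. *)
Definition CkM (k : nat) f := forall c, Ck_on k (img c) (fun u => f (param c u)).

Lemma open_chart_img c : open (img c). Proof. exact: open_img. Qed.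

Lemma img_coord c x : dom c x -> img c (coord c x).
Proof. by move=> cx; exists x. Qed.

Lemma dom_param c u : img c u -> dom c (param c u).
Proof. by case=> x cx <-; rewrite coordK. Qed.

Lemma paramK c u : img c u -> coord c (param c u) = u.
Proof. by case=> x cx <-; rewrite coordK. Qed.

Lemma open_param_preimage c (W : set M) : open W ->
  open (img c `&` (param c @^-1` W)).
Proof.
move=> oW; rewrite openE => u [cu Wu]; apply: filterI.
  by apply: open_nbhs_nbhs; split=> //; exact: open_chart_img.
by apply: (continuous_param cu); exact: open_nbhs_nbhs.
Qed.

Lemma overlapE c d : coord c @` (dom c `&` dom d) = img c `&` (param c @^-1` dom d).
Proof.
apply/seteqP; split=> u [].
  by move=> x [cx dx] <-; split; [exists x|rewrite /= coordK].
by move=> cu /= du; exists (param c u); [split; [exact: dom_param|]|exact: paramK].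
Qed.

Lemma open_overlap c d : open (coord c @` (dom c `&` dom d)).
Proof. by rewrite overlapE; exact/open_param_preimage/open_dom. Qed.

Lemma continuous_at_chart c f x : dom c x ->
  {for coord c x, continuous (fun u => f (param c u))} -> {for x, continuous f}.
Proof.
move=> cx cf; have h : {for x, continuous ((fun u => f (param c u)) \o coord c)}.
  by apply: continuous_comp => //; exact: continuous_coord.
apply: near_eq_continuous_at h.
have : nbhs x (dom c) by apply: open_nbhs_nbhs; split=> //; exact: open_dom.
by apply: filterS => y cy /=; rewrite coordK.
Qed.

Lemma CkM_continuous k f : CkM k f -> continuous f.
Proof.
move=> hf x; apply: (@continuous_at_chart (chart_at x)); first exact: chart_atP.
exact: (Ck_on_continuous (hf _)) (img_coord (chart_atP x)).
Qed.

Lemma smoothP f : smooth f <-> forall k, CkM k f.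
Proof. by split=> h; [move=> k c|move=> c k]; exact: h. Qed.

Lemma CkM_leq k l f : (k <= l)%N -> CkM l f -> CkM k f.
Proof. by move=> kl hf c; exact: Ck_on_leq (hf c). Qed.

Lemma CkM_cst k (a : R) : CkM k (fun=> a).
Proof. by move=> c; exact: Ck_on_cst. Qed.

Lemma CkM_add k f g : CkM k f -> CkM k g -> CkM k (fun x => f x + g x).
Proof. by move=> hf hg c; apply: Ck_on_add; [exact: open_chart_img|exact: hf|exact: hg]. Qed.

Lemma CkM_mul k f g : CkM k f -> CkM k g -> CkM k (fun x => f x * g x).
Proof. by move=> hf hg c; apply: Ck_on_mul; [exact: open_chart_img|exact: hf|exact: hg]. Qed.

Lemma CkM_opp k f : CkM k f -> CkM k (fun x => - f x).
Proof. by move=> hf c; apply: Ck_on_opp; [exact: open_chart_img|exact: hf]. Qed.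

Lemma CkM_inv k f : (forall x, f x != 0) -> CkM k f -> CkM k (fun x => (f x)^-1).
Proof.
by move=> f0 hf c; apply: Ck_on_inv; [exact: open_chart_img|move=> u _; exact: f0|exact: hf].
Qed.

Lemma CkM_sum k (I : Type) (r : seq I) (F : I -> M -> R) :
  (forall i, CkM k (F i)) -> CkM k (fun x => \sum_(i <- r) F i x).
Proof.
by move=> hF c; apply: Ck_on_sum; [exact: open_chart_img|move=> i _; exact: hF].
Qed.

Lemma transition_Ck k c d (j : 'I_n) :
  Ck_on k (coord c @` (dom c `&` dom d)) (fun u => coord d (param c u) 0 j).
Proof. exact: smooth_transition. Qed.

Lemma overlap_img c d u : (coord c @` (dom c `&` dom d)) u ->
  img d (coord d (param c u)).
Proof. by case=> x [cx dx] <-; rewrite coordK//; exact: img_coord. Qed.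

Lemma partial_change_chart c d f x (i : 'I_n) : CkM 1 f -> dom c x -> dom d x ->
  partial i (fun u => f (param c u)) (coord c x) =
  \sum_(j < n) jacobian_coord c d (coord c x) i j *
    partial j (fun u => f (param d u)) (coord d x).
Proof.
move=> hf cx dx.
have Ux : (coord c @` (dom c `&` dom d)) (coord c x) by exists x.
have [_ E] := @partial_comp R n n _ _ (fun u => f (param d u))
  (fun u => coord d (param c u)) (coord c x) i (@open_overlap c d)
  (@open_chart_img d) Ux (overlap_img Ux) (hf d) (fun j => @transition_Ck 1 c d j).
transitivity (partial i ((fun u => f (param d u)) \o (fun u => coord d (param c u)))
    (coord c x)).
  apply: near_eq_derive; apply: (@open_near_eq _ _ _ _ _ _ (@open_overlap c d) _ Ux).
  by move=> _ [y [cy dy] <-] /=; rewrite !coordK.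
rewrite E; apply: eq_bigr => j _; rewrite mxE.
by congr (_ * partial _ _ _); rewrite coordK.
Qed.

Hypothesis hcompact : compact [set: M].

Lemma closed_compact (S : set M) : closed S -> compact S.
Proof. by move=> cS; exact: subclosed_compact cS hcompact (@subsetT _ _). Qed.

Lemma coord_image_compact c (S : set M) : closed S -> S `<=` dom c ->
  compact (coord c @` S).
Proof.
move=> cS Sc; apply: continuous_compact; last exact: closed_compact.
by apply: continuous_in_subspaceT => x /set_mem/Sc; exact: continuous_coord.
Qed.

Lemma chart_patch k c (S : set M) (G : 'rV[R]_n -> R) :
  closed S -> S `<=` dom c -> Ck_on k (img c) G ->
  (forall u, img c u -> ~ S (param c u) -> G u = 0) ->
  Ck_on k setT (patch (fun=> 0) (img c) G) /\
  exists K : R, csupp K (patch (fun=> 0) (img c) G).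
Proof.
move=> cS Sc hG G0; have cC := coord_image_compact cS Sc.
have P0 u : ~ (coord c @` S) u -> patch (fun=> 0) (img c) G u = 0.
  move=> Su; rewrite patchE; case: ifPn => // /set_mem cu.
  by apply: G0 => // Sp; apply: Su; exists (param c u) => //; exact: paramK.
split.
  apply: Ck_on_local => u _; have [Su|Su] := pselect ((coord c @` S) u).
    exists (img c); first by case: Su => x /Sc cx <-; exact: img_coord.
    apply: Ck_on_ext hG; first exact: open_chart_img.
    by move=> v cv; rewrite patchE mem_set.
  exists (~` (coord c @` S)) => //.
  apply: Ck_on_ext (Ck_on_cst k _ 0); first last.
    by move=> v /P0 ->.
  exact: (closed_openC (compact_closed (@norm_hausdorff R 'rV[R]_n) cC)).
have [K [_ hK]] := compact_bounded cC.
exists (K + 1) => u uK; apply: P0 => Su.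
have K1 : K < K + 1 by rewrite ltrDl.
have /= := hK _ K1 u Su.
by rewrite leNgt uK.
Qed.

End Manifold.

(** * Bump functions and partitions of unity *)

Lemma is_derive_max0_sqr (R : realType) (s : R) :
  is_derive s 1 (fun x : R => Num.max 0 x ^+ 2) (2 * Num.max 0 s).
Proof.
have [s0|s0|->] := ltgtP s 0.
- rewrite mulr0; apply: (near_eq_is_derive _ (is_derive_cst (0 : R) (s : R) (1 : R))).
  apply: filterS (lt_nbhsl s0) => x x0.
  by rewrite (max_idPl (ltW x0)) expr0n.
- have : is_derive s 1 (fun x : R => x ^+ 2) (2 * s).
    have := @derivableP _ _ _ _ s 1 (@exprn_derivable R 2 s 1).
    by rewrite exp_derive expr1 /GRing.scale/= mulr1.
  apply: near_eq_is_derive; apply: filterS (lt_nbhsr s0) => x x0.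
  by rewrite (max_idPr (ltW x0)).
- rewrite mulr0.
  pose p (x : R) : R := Num.max 0 x ^+ 2.
  (* At the corner the difference quotient is at most [|h|] in absolute value, since the positive
     part of [h] is at most [|h|]. *)
  have h : (fun h : R => h^-1 *: ((p \o shift 0) (h *: (1 : R)) - p 0)) @ (0 : R)^' --> (0 : R).
    apply/cvgrPdist_lt => e e0; rewrite near_withinE.
    apply: filterS (nbhs0_lt e0) => h he h0.
    rewrite sub0r normrN /p /= maxxx expr0n subr0 addr0 normrZ normrX.
    have -> : h *: (1 : R) = h by rewrite /GRing.scale/= mulr1.
    apply: le_lt_trans he; rewrite normfV ler_pdivrMl ?normr_gt0// expr2.
    have m : `|Num.max 0 h| <= `|h|.
      rewrite ger0_norm ?le_max ?lexx// ge_max normr_ge0 ler_norm//.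
    by rewrite ler_pM.
  split; first by apply/cvg_ex; exists 0.
  by apply/cvg_lim.
Qed.

Lemma C1_max0_sqr (R : realType) (n : nat) (U : set 'rV[R]_n) f :
  open U -> Ck_on 1 U f -> Ck_on 1 U (fun u => Num.max 0 (f u) ^+ 2).
Proof.
move=> oU hf.
have cm : continuous (fun x : R => Num.max 0 x).
  by move=> x; apply: (@continuous_max _ _ (cst 0) id); [exact: cst_continuous|exact: cvg_id].
have cf u : U u -> {for u, continuous f} by exact: Ck_on_continuous hf u.
have cmf u : U u -> {for u, continuous (fun w => Num.max 0 (f w))}.
  by move=> Uu; apply: (@continuous_comp _ _ _ f (Num.max 0)); [exact: cf|exact: cm].
have [_ hp] := hf.
have D i u : U u -> is_derive u (delta_mx 0 i : 'rV[R]_n)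
    (fun w => Num.max 0 (f w) ^+ 2) (2 * Num.max 0 (f u) * partial i f u).
  move=> Uu; have [df _] := hp i.
  exact: (is_derive_comp1 (df u Uu) (is_derive_max0_sqr (f u))).
split=> [u Uu|i].
  by have := cvgM (cmf u Uu) (cmf u Uu); apply.
split=> [u Uu|]; first by have [] := D i u Uu.
have [_ [cp _]] := hp i.
apply: (Ck_on_ext oU (f := fun u => 2 * Num.max 0 (f u) * partial i f u)).
  by move=> u /(D i)[].
split=> // u Uu.
have c2 : {for u, continuous (fun=> 2 : R)} by exact: cst_continuous.
exact: (cvgM (cvgM c2 (cmf u Uu)) (cp u Uu)).
Qed.

(** The squared positive part of [r^2] minus the squared Euclidean distance to [a]. That distance is
    used because its square is polynomial, and its ball lies in the sup ball of the same radius. *)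
Lemma rV_bump (R : realType) (n : nat) (a : 'rV[R]_n) (r : R) : 0 < r ->
  exists b : 'rV[R]_n -> R, [/\ Ck_on 1 setT b, forall u, 0 <= b u, 0 < b a &
    forall u, b u != 0 -> `|u - a| <= r].
Proof.
move=> r0; pose q (u : 'rV[R]_n) := r ^+ 2 - \sum_(j < n) (u 0 j - a 0 j) * (u 0 j - a 0 j).
exists (fun u => Num.max 0 (q u) ^+ 2); split.
- apply: C1_max0_sqr; first exact: openT.
  have oT := @openT 'rV[R]_n.
  apply: Ck_on_sub => //; first exact: Ck_on_cst.
  apply: Ck_on_sum => // j _.
  by apply: Ck_on_mul => //; apply: Ck_on_sub => //;
    (exact: Ck_on_coord || exact: Ck_on_cst).
- by move=> u; rewrite sqr_ge0.
- have -> : q a = r ^+ 2.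
    by rewrite /q big1 ?subr0// => j _; rewrite subrr mul0r.
  by rewrite exprn_gt0// lt_max exprn_gt0 ?orbT.
move=> u; rewrite sqrf_eq0; have [qu|qu] := leP (q u) 0.
  by rewrite eqxx.
move=> _; apply: row_norm_le; first exact: ltW.
move=> j; rewrite !mxE -[leRHS](gtr0_norm r0) -ler_sqr ?nnegrE// !real_normK ?num_real//.
apply/ltW; rewrite -subr_gt0; apply: (lt_le_trans qu).
rewrite lerD2l lerN2 (bigD1 j)//= -expr2 lerDl sumr_ge0// => k _.
by rewrite -expr2 sqr_ge0.
Qed.

Section Bump.
Context (R : realType) (n : nat) (M : smoothManifold R n).
Hypothesis hcompact : compact [set: M].

(* Class C^1 suffices: the volume is only tested against continuous functions,
   and one derivative is integrated by parts. *)
Lemma CkM_bump (c : chart M) (x0 : M) (W : set M) : open W -> W x0 -> dom c x0 ->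
  exists phi : M -> R, [/\ CkM 1 phi, forall x, 0 <= phi x, 0 < phi x0 &
    closure [set x | phi x != 0] `<=` W `&` dom c].
Proof.
move=> oW Wx0 cx0; set a := coord c x0.
pose U := img c `&` (param c @^-1` W).
have oU : open U by exact: open_param_preimage.
have Ua : U a by split; [exact: img_coord|rewrite /= coordK].
have [r r0 rU] : exists2 r : R, 0 < r & forall u, `|u - a| <= r -> U u.
  have /nbhs_ballP[e /= e0 eU] : nbhs a U by exact: open_nbhs_nbhs.
  exists (e / 2); first by rewrite divr_gt0.
  move=> u ue; apply: eU; rewrite -ball_normE /= distrC (le_lt_trans ue)//.
  by rewrite ltr_pdivrMr// ltr_pMr// ltr1n.
have [b [b1 b0 ba bs]] := rV_bump a r0.
pose B := [set u : 'rV[R]_n | `|u - a| <= r].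
have cB : compact B.
  apply: bounded_closed_compact.
    exists (`|a| + r); split; first exact: num_real.
    move=> N aN u ur; apply: (@le_trans _ _ (`|u - a| + `|a|)).
      by rewrite -{1}(subrK a u) ler_normD.
    by apply: ltW; apply: le_lt_trans aN; rewrite addrC lerD2l.
  apply: (@preimage_closed _ _ (fun u : 'rV[R]_n => `|u - a|) [set x | x <= r]); last exact: closed_le.
  move=> u _; apply: (@continuous_comp _ _ _ (fun u : 'rV[R]_n => u - a) (fun u : 'rV[R]_n => `|u|)).
    have ca : {for u, continuous (fun=> - a)} by exact: cst_continuous.
    exact: (cvgD cvg_id ca).
  exact: norm_continuous.
(* A compact set, hence closed since the manifold is Hausdorff. This makes the extension by zero
   regular across the boundary of the chart and keeps the closed support inside [W] and [dom c]. *)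
pose K := param c @` B.
have cK : closed K.
  apply: compact_closed; first exact: manifold_hausdorff.
  apply: continuous_compact => //.
  by apply: continuous_in_subspaceT => u /set_mem/rU[cu _]; exact: continuous_param.
have KW : K `<=` W `&` dom c.
  by move=> _ [u /rU[cu Wu] <-]; split=> //; exact: dom_param.
pose phi x := patch (fun=> 0) (dom c) (fun x => b (coord c x)) x.
have phiE x : dom c x -> phi x = b (coord c x) by move=> cx; rewrite /phi patchE mem_set.
have phi0 x : ~ K x -> phi x = 0.
  move=> Kx; rewrite /phi patchE; case: ifPn => // /set_mem cx.
  apply/eqP/negPn/negP => /bs bx; apply: Kx.
  by exists (coord c x) => //; exact: coordK.
exists phi; split.
(* At points of [K] the function is read in [d] through the transition map; off [K] it vanishes on
   an open set. *)
- move=> d; apply: Ck_on_local => u du; have [Ku|Ku] := pselect (K (param d u)).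
    exists (coord d @` (dom d `&` dom c)).
      by exists (param d u); [split; [exact: dom_param|exact: (KW _ Ku).2]|exact: paramK].
    have h := @Ck_on_comp R n n 1 _ _ b (fun u => coord c (param d u))
      (@open_overlap _ _ _ d c) (@openT _) (fun _ _ => I) b1 (fun j => @transition_Ck _ _ _ 1 d c j).
    apply: (Ck_on_ext (@open_overlap _ _ _ d c) _ h) => v.
    by rewrite overlapE => -[dv /= cv]; rewrite phiE.
  exists (img d `&` (param d @^-1` (~` K))) => //.
  apply: (Ck_on_ext _ _ (Ck_on_cst 1 _ 0)).
    by apply: open_param_preimage; exact: closed_openC.
  by move=> v [_ /= Kv]; rewrite phi0.
- by move=> x; rewrite /phi patchE; case: ifPn.
- by rewrite phiE.
apply: subset_trans KW; rewrite (_ : K = closure K); last exact/closure_id.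
apply: closureS => x /= px; apply: contrapT => Kx.
by move: px; rewrite phi0// eqxx.
Qed.

(** Finitely many positivity sets of bumps cover the compact manifold, so the sum of these bumps is
    positive and can be divided by. Indexing by points attaches to each piece the chart
    [chart_at y]. *)
Lemma partition_of_unity :
  exists (s : seq M) (chi : M -> M -> R),
    [/\ forall y, CkM 1 (chi y),
        forall y, closure [set x | chi y x != 0] `<=` dom (chart_at y) &
        forall x, \sum_(y <- s) chi y x = 1].
Proof.
have ex y : exists phi : M -> R, [/\ CkM 1 phi, forall x, 0 <= phi x, 0 < phi y &
    closure [set x | phi x != 0] `<=` dom (chart_at y)].
  have [phi [p1 p2 p3 p4]] := CkM_bump (@openT M) I (chart_atP y).
  by exists phi; split=> //; move: p4; rewrite setTI.
have [phi hphi] := choice ex.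
pose V (y : M) : set M := [set x | 0 < phi y x].
have oV y : open (V y).
  have [p1 _ _ _] := hphi y.
  apply: (@open_comp _ _ (phi y) [set x | 0 < x]); last exact: open_gt.
  by move=> x _; exact: (CkM_continuous p1).
have := hcompact; rewrite compact_cover => /(_ M setT V (fun y _ => oV y)).
case; first by move=> x _; exists x => //; have [] := hphi x.
move=> D _ Dcov.
pose s : seq M := enum_fset D.
have S0 x : 0 < \sum_(y <- s) phi y x.
  have [y yD yx] := Dcov x I.
  rewrite (bigD1_seq y)//=; last exact: fset_uniq.
  by rewrite ltr_wpDr// sumr_ge0// => z _; have [_ + _ _] := hphi z; exact.
exists s, (fun y x => phi y x / \sum_(z <- s) phi z x); split.
- move=> y; apply: CkM_mul; first by have [] := hphi y.
  apply: CkM_inv; first by move=> x; rewrite gt_eqF.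
  by apply: CkM_sum => z; have [] := hphi z.
- move=> y; have [_ _ _] := hphi y; apply: subset_trans; apply: closureS => x /=.
  by apply: contra_neq => ->; rewrite mul0r.
- by move=> x; rewrite -mulr_suml divff// gt_eqF.
Qed.

End Bump.

(** * The inner product of gradients *)

(* [char_poly (- A)] is monic without nonnegative root. *)
Lemma posdef_det_gt0 (R : realType) (n : nat) (A : 'M[R]_n) :
  (forall v : 'rV[R]_n, v != 0 -> 0 < (v *m A *m v^T) 0 0) -> 0 < \det A.
Proof.
move=> hA; pose p := char_poly (- A).
have p0 : p.[0] = \det A.
  rewrite horner_coef0 char_poly_det -(scaleN1r A) detZ mulrA -exprMn mulrNN mulr1.
  by rewrite expr1n mul1r.
(* An eigenvector [v] of [- A] for [a >= 0] would satisfy [v A v^T = - a |v|^2 <= 0]. *)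
have nr a : 0 <= a -> ~~ root p a.
  move=> a0; rewrite -eigenvalue_root_char; apply/eigenvalueP => -[v vA v0].
  have := hA _ v0; rewrite -[A]opprK mulmxN vA mulNmx -scalemxAl mxE mxE.
  apply/negP; rewrite -leNgt oppr_le0 mulr_ge0// mxE sumr_ge0// => j _.
  by rewrite mxE -expr2 sqr_ge0.
rewrite ltNge; apply/negP; rewrite -p0 => pn.
have lc : lead_coef p = 1 by apply/eqP; rewrite -monicE char_poly_monic.
(* Far to the right a monic polynomial is at least 1, so a nonpositive value at 0 would force a root
   in between. *)
have [N hN] : exists N, forall x, x >= N -> p.[x] >= lead_coef p.
  by apply: polyrcf.poly_pinfty_gt_lc; rewrite lc.
pose b := Num.max 0 N.
have b0 : 0 <= b by rewrite le_max lexx.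
have pb : 0 <= p.[b].
  by apply: (le_trans _ (hN b _)); rewrite ?lc// le_max lexx orbT.
have [|x /andP[x0 _] rx] := poly_ivt (p := p) b0; first by rewrite pn.
by have := nr x x0; rewrite rx.
Qed.

Lemma Ck_on_det (R : realType) (m n k : nat) (U : set 'rV[R]_m)
    (A : 'rV[R]_m -> 'M[R]_n) : open U ->
  (forall i j, Ck_on k U (fun u => A u i j)) -> Ck_on k U (fun u => \det (A u)).
Proof.
move=> oU hA; apply: Ck_on_sum => // s _; apply: Ck_on_mul => //.
  exact: Ck_on_cst.
by apply: Ck_on_prod => // i _; exact: hA.
Qed.

Lemma Ck_on_invmx (R : realType) (m n k : nat) (U : set 'rV[R]_m)
    (A : 'rV[R]_m -> 'M[R]_n) i j : open U ->
  (forall u, U u -> \det (A u) != 0) ->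
  (forall i j, Ck_on k U (fun u => A u i j)) ->
  Ck_on k U (fun u => invmx (A u) i j).
Proof.
move=> oU d0 hA.
(* The entries of the inverse as cofactors over the determinant, which involve only sums, products
   and one inversion. *)
have hc : Ck_on k U (fun u => (\det (A u))^-1 * ((-1) ^+ (j + i) * \det (row' j (col' i (A u))))).
  apply: Ck_on_mul => //; first exact: (Ck_on_inv oU d0 (Ck_on_det oU hA)).
  apply: Ck_on_mul => //; first exact: Ck_on_cst.
  apply: Ck_on_det => // a b.
  by apply: (Ck_on_ext oU _ (hA (lift j a) (lift i b))) => u _; rewrite !mxE.
apply: (Ck_on_ext oU _ hc) => u Uu.
by rewrite /invmx unitmxE unitfE d0// !mxE.
Qed.

Section Metric.
Context (R : realType) (n : nat) (M : smoothManifold R n) (g : riemannianMetric M).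
Implicit Types (c d : chart M) (rho theta phi : M -> R) (x : M) (u : 'rV[R]_n).

Lemma gmx_det_gt0 c u : img c u -> 0 < \det (g c u).
Proof. by move=> cu; apply: posdef_det_gt0 => v v0; exact: gmx_posdef. Qed.

Lemma gmx_unit c u : img c u -> g c u \in unitmx.
Proof. by move=> cu; rewrite unitmxE unitfE gt_eqF// gmx_det_gt0. Qed.

Lemma vol_density_gt0 c u : img c u -> 0 < vol_density g c u.
Proof. by move=> cu; rewrite sqrtr_gt0 gmx_det_gt0. Qed.

Lemma Ck_on_vol_density k c : Ck_on k (img c) (vol_density g c).
Proof.
apply: Ck_on_sqrt; [exact: open_chart_img|exact: gmx_det_gt0|].
by apply: Ck_on_det; [exact: open_chart_img|move=> i j; exact: smooth_gmx].
Qed.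

Lemma Ck_on_inv_gmx k c i j : Ck_on k (img c) (fun u => invmx (g c u) i j).
Proof.
apply: Ck_on_invmx; [exact: open_chart_img| |move=> a b; exact: smooth_gmx].
by move=> u cu; rewrite gt_eqF// gmx_det_gt0.
Qed.

Definition drow (f : M -> R) (c : chart M) (u : 'rV[R]_n) : 'rV[R]_n :=
  \row_j partial j (fun v => f (param c v)) u.

(** The inner product of the two gradients, expressed on differentials: the inverse Gram matrix is
    the metric on covectors. *)
Definition local_ip (theta phi : M -> R) (c : chart M) (u : 'rV[R]_n) : R :=
  (drow theta c u *m invmx (g c u) *m (drow phi c u)^T) 0 0.

Definition ip (theta phi : M -> R) (x : M) : R :=
  local_ip theta phi (chart_at x) (coord (chart_at x) x).

Lemma drow_change_chart c d f x : CkM 1 f -> dom c x -> dom d x ->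
  drow f c (coord c x) =
  drow f d (coord d x) *m (jacobian_coord c d (coord c x))^T.
Proof.
move=> hf cx dx; apply/rowP => i; rewrite mxE (partial_change_chart i hf cx dx) mxE.
by apply: eq_bigr => j _; rewrite [drow _ _ _ _ _]mxE [_^T _ _]mxE mulrC.
Qed.

(** With [J] the Jacobian, differentials contribute [J^T] and [J], the inverse Gram matrix
    contributes the inverses of these, and everything cancels. *)
Lemma local_ip_change_chart c d theta phi x : CkM 1 theta -> CkM 1 phi ->
  dom c x -> dom d x ->
  local_ip theta phi c (coord c x) = local_ip theta phi d (coord d x).
Proof.
move=> ht hp cx dx; rewrite /local_ip.
rewrite (drow_change_chart ht cx dx) (drow_change_chart hp cx dx).
have E := gmx_compat g cx dx.
have uc := gmx_unit (img_coord cx); have ud := gmx_unit (img_coord dx).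
set J := jacobian_coord c d (coord c x) in E *.
(* The transformation law writes an invertible Gram matrix as a product with [J] as a factor, which
   yields invertibility of the Jacobian without differentiating the inverse transition. *)
have uJ : J \in unitmx.
  by move: uc; rewrite E !unitmxE !det_mulmx !unitrM => /andP[/andP[]].
have uJT : J^T \in unitmx by rewrite unitmx_tr.
rewrite E trmx_mul trmxK; congr (fun_of_matrix _ 0 0).
have -> : invmx (J *m g d (coord d x) *m J^T) =
    invmx J^T *m invmx (g d (coord d x)) *m invmx J.
  have uP : J *m g d (coord d x) *m J^T \in unitmx by rewrite -E.
  apply: (can_inj (mulmxK uP)); rewrite mulVmx//.
  by rewrite -!mulmxA (mulKmx uJ) (mulKmx ud) mulVmx.
by rewrite -!mulmxA (mulKVmx uJT) (mulKmx uJ).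
Qed.

Lemma ip_param theta phi c u : CkM 1 theta -> CkM 1 phi -> img c u ->
  ip theta phi (param c u) = local_ip theta phi c u.
Proof.
move=> ht hp cu; rewrite /ip -[u in RHS](paramK cu).
by apply: local_ip_change_chart => //; [exact: chart_atP|exact: dom_param].
Qed.

Lemma local_ipE theta phi c u :
  local_ip theta phi c u = \sum_(i < n) (\sum_(j < n)
    partial j (fun v => theta (param c v)) u * invmx (g c u) j i) *
    partial i (fun v => phi (param c v)) u.
Proof.
rewrite /local_ip mxE; apply: eq_bigr => i _; rewrite !mxE; congr (_ * _).
by apply: eq_bigr => j _; rewrite mxE.
Qed.

Lemma CkM_partial k c f i : CkM k.+1 f ->
  Ck_on k (img c) (partial i (fun v => f (param c v))).
Proof. by move=> hf; have [_ /(_ i)[]] := hf c. Qed.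

Lemma CkM_ip k theta phi : CkM k.+1 theta -> CkM k.+1 phi -> CkM k (ip theta phi).
Proof.
move=> ht hp c; have oc := @open_chart_img _ _ _ c.
have h : Ck_on k (img c) (local_ip theta phi c).
  apply: (Ck_on_ext oc (f := fun u => \sum_(i < n) (\sum_(j < n)
    partial j (fun v => theta (param c v)) u * invmx (g c u) j i) *
    partial i (fun v => phi (param c v)) u)); first by move=> u _; rewrite local_ipE.
  apply: Ck_on_sum => // i _; apply: Ck_on_mul => //; last exact: CkM_partial.
  apply: Ck_on_sum => // j _; apply: Ck_on_mul => //; first exact: CkM_partial.
  exact: Ck_on_inv_gmx.
apply: (Ck_on_ext oc _ h) => u cu; rewrite ip_param//.
  exact: (CkM_leq (isT : (1 <= k.+1)%N)).
exact: (CkM_leq (isT : (1 <= k.+1)%N)).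
Qed.

Lemma normsq_grad theta x : normsq g (grad g theta) x = ip theta theta x.
Proof.
rewrite /normsq /ip /local_ip /grad; set c := chart_at x; set u := coord c x.
have cu : img c u by apply: img_coord; exact: chart_atP.
rewrite -/(drow theta c u) trmx_mul trmx_inv gmx_sym// !mulmxA.
by rewrite (mulmxKV (gmx_unit cu)).
Qed.

Lemma drow_lin e theta phi c u : CkM 1 theta -> CkM 1 phi -> img c u ->
  drow (fun x => theta x + e * phi x) c u = drow theta c u + e *: drow phi c u.
Proof.
move=> ht hp cu; apply/rowP => i; rewrite !mxE.
have [_ /(_ i)[dt _]] := ht c; have [_ /(_ i)[dp _]] := hp c.
rewrite /partial deriveD; [|exact: dt|]; last first.
  by apply: derivableM; [exact: derivable_cst|exact: dp].
congr (_ + _); have := deriveZ e (dp u cu); exact.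
Qed.

Lemma local_ipC theta phi c u : img c u -> local_ip theta phi c u = local_ip phi theta c u.
Proof.
move=> cu; rewrite /local_ip.
set a := drow theta c u; set b := drow phi c u; set G := invmx (g c u).
have GT : G^T = G by rewrite trmx_inv gmx_sym.
transitivity ((a *m G *m b^T)^T 0 0); first by rewrite [RHS]mxE.
by rewrite !trmx_mul trmxK GT mulmxA.
Qed.

Lemma ipC theta phi x : ip theta phi x = ip phi theta x.
Proof. by apply: local_ipC; apply: img_coord; exact: chart_atP. Qed.

Lemma ip_linr e theta phi psi x : CkM 1 phi -> CkM 1 psi ->
  ip theta (fun y => phi y + e * psi y) x = ip theta phi x + e * ip theta psi x.
Proof.
move=> hp hq; rewrite /ip; set c := chart_at x; set u := coord c x.
have cu : img c u by apply: img_coord; exact: chart_atP.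
rewrite /local_ip drow_lin// linearD/= [(e *: _)^T]linearZ/= mulmxDr -scalemxAr.
by rewrite mxE; congr (_ + _); rewrite mxE.
Qed.

Lemma ip_quadratic e theta phi x : CkM 1 theta -> CkM 1 phi ->
  ip (fun x => theta x + e * phi x) (fun x => theta x + e * phi x) x =
  ip theta theta x + 2 * e * ip theta phi x + e ^+ 2 * ip phi phi x.
Proof.
move=> ht hp; rewrite ip_linr//.
have E psi : ip (fun y => theta y + e * phi y) psi x =
    ip psi theta x + e * ip psi phi x by rewrite ipC ip_linr.
rewrite !E (ipC phi theta).
by move: (ip theta theta x) (ip theta phi x) (ip phi phi x) => p q r; ring.
Qed.

End Metric.

(** * The divergence theorem *)

Section ChartDivergence.
Context (R : realType) (n : nat) (M : smoothManifold R n).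
Hypothesis hcompact : compact [set: M].
Variables (c : chart M) (S : set M) (phi : M -> R) (W : 'I_n -> 'rV[R]_n -> R).
Hypotheses (cS : closed S) (Sc : S `<=` dom c) (hphi : CkM 1 phi)
  (phi0 : forall x, ~ S x -> phi x = 0) (hW : forall i, Ck_on 1 (img c) (W i)).

Let phic u := phi (param c u).

Lemma phi_near0 u : img c u -> ~ S (param c u) -> {near u, phic =1 fun=> 0}.
Proof.
move=> cu Su; have o : open (img c `&` (param c @^-1` (~` S))).
  by apply: open_param_preimage; exact: closed_openC.
by apply: (open_near_eq o) => // v [_ Sv]; exact: phi0.
Qed.

Lemma partial_phi0 i u : img c u -> ~ S (param c u) -> partial i phic u = 0.
Proof.
by move=> cu Su; rewrite /partial (near_eq_derive _ (phi_near0 cu Su)) derive_cst.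
Qed.

(** The products [phi W_i], extended by zero, are C^1 on the whole space thanks to the support of
    [phi], whatever [W] does near the boundary of the chart. Their partial derivatives integrate to
    zero, and the Leibniz rule splits the sum into the two sides. *)
Lemma chart_ibp :
  integral_rV (patch (fun=> 0) (img c) (fun u => \sum_(i < n) W i u * partial i phic u)) =
  - integral_rV (patch (fun=> 0) (img c) (fun u => phic u * \sum_(i < n) partial i (W i) u)).
Proof.
have oc := @open_chart_img _ _ _ c.
have Cp i : Ck_on 0 (img c) (partial i phic) by exact: CkM_partial.
have CW i : Ck_on 0 (img c) (partial i (W i)) by have [_ /(_ i)[]] := hW i.
set L := fun u => \sum_(i < n) W i u * partial i phic u.
set Q := fun u => phic u * \sum_(i < n) partial i (W i) u.
have ccP (G : 'rV[R]_n -> R) : Ck_on 0 (img c) G ->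
    (forall u, img c u -> ~ S (param c u) -> G u = 0) -> cc (patch (fun=> 0) (img c) G).
  move=> hG G0; have [h1 h2] := chart_patch hcompact cS Sc hG G0.
  by split=> // u; exact: (Ck_on_continuous h1).
have ccL : cc (patch (fun=> 0) (img c) L).
  apply: ccP => [|u cu Su].
    by apply: Ck_on_sum => // i _; apply: Ck_on_mul => //; exact: Ck_onW (hW i).
  by rewrite /L big1// => i _; rewrite partial_phi0// mulr0.
have ccQ : cc (patch (fun=> 0) (img c) Q).
  apply: ccP => [|u cu Su].
    apply: Ck_on_mul => //; first exact: Ck_onW (hphi c).
    exact: Ck_on_sum.
  by rewrite /Q /phic phi0// mul0r.
pose P i := patch (fun=> 0) (img c) (fun u => phic u * W i u).
have hP i : Ck_on 1 setT (P i) /\ exists K : R, csupp K (P i).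
  apply: (chart_patch hcompact cS Sc) => [|u cu Su]; last by rewrite /phic phi0// mul0r.
  by apply: Ck_on_mul => //; exact: hphi.
have IP i : cc (partial i (P i)) /\ integral_rV (partial i (P i)) = 0.
  by have [h1 [K h2]] := hP i; exact: integral_rV_partial h2.
apply/eqP; rewrite -subr_eq0 opprK -[X in X + _]mul1r -integral_rV_lin//; apply/eqP.
have [_ +] := cc_sum (index_enum _) (fun i => (IP i).1).
rewrite [X in _ = X]big1; last by move=> i _; exact: (IP i).2.
move=> IS; rewrite -[RHS]IS; congr integral_rV; apply/funext => u; rewrite mul1r.
have [cu|cu] := pselect (img c u).
  rewrite !patchE mem_set// /L /Q mulr_sumr -big_split/=; apply: eq_bigr => i _.
  have -> : partial i (P i) u = partial i (fun u => phic u * W i u) u.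
    apply: near_eq_derive; apply: (open_near_eq oc) => // v cv.
    by rewrite /P patchE mem_set.
  have [_ /(_ i)[dp _]] := hphi c; have [_ /(_ i)[dW _]] := hW i.
  rewrite /partial deriveM; [|exact: dp|exact: dW].
  by rewrite addrC; congr (_ + _); rewrite -/(partial i phic u) mulrC.
rewrite !patchE memNset// addr0 big1// => i _.
have oC : open (~` (coord c @` S)).
  exact: (closed_openC (compact_closed (@norm_hausdorff R 'rV[R]_n)
    (coord_image_compact hcompact cS Sc))).
have uC : (~` (coord c @` S)) u by case=> x /Sc cx xu; apply: cu; rewrite -xu; exact: img_coord.
rewrite /partial (@near_eq_derive _ _ _ _ (cst 0)) ?derive_cst//.
apply: (open_near_eq oC) => // v Cv; rewrite /P patchE; case: ifPn => // /set_mem cv.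
rewrite /phic phi0 ?mul0r// => Sv; apply: Cv; exists (param c v) => //.
exact: paramK.
Qed.

End ChartDivergence.

(** * Integration against the volume and the divergence in one chart *)

Section Volume.
Context (R : realType) (n : nat) (M : smoothManifold R n) (g : riemannianMetric M).
Context (mu : probability (borel M) R).
Hypotheses (hcompact : compact [set: M]) (hmu : is_riemannian_volume g mu).
Implicit Types (c d : chart M) (f rho theta phi : M -> R) (x : M).

Lemma continuous_integrable f : continuous f ->
  mu.-integrable setT (EFin \o (f : borel M -> R)).
Proof.
move=> cf; apply: measurable_bounded_integrable => //.
- by rewrite (@le_lt_trans _ _ 1%E) ?ltry//; exact: probability_le1.
- apply: (measurability _ (RGenOpens.measurableE R)).
  move=> _ [_ [a [b ->] <-]]; rewrite setTI; apply: sub_sigma_algebra.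
  by apply: (@open_comp _ _ f) => [x _|]; [exact: cf|exact: interval_open].
- have cfT : compact (f @` [set: M]).
    by apply: continuous_compact => //; exact: continuous_subspaceT.
  have [K [Kr hK]] := compact_bounded cfT.
  exists K; split=> // N KN x _; apply: (hK _ KN); by exists x.
Qed.

Lemma int_lin (a : R) f h : continuous f -> continuous h ->
  \int[mu]_x (a * f x + h x) = a * \int[mu]_x f x + \int[mu]_x h x.
Proof.
move=> cf ch; have If := continuous_integrable cf; have Ih := continuous_integrable ch.
rewrite RintegralD//; last exact: (integrableZl measurableT a If).
by rewrite RintegralZl.
Qed.

Lemma int_sum (I : Type) (r : seq I) (F : I -> M -> R) :
  (forall i, continuous (F i)) ->
  continuous (fun x => \sum_(i <- r) F i x) /\
  \int[mu]_x (\sum_(i <- r) F i x) = \sum_(i <- r) \int[mu]_x F i x.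
Proof.
move=> hF; elim: r => [|i r [IH1 IH2]].
  have -> : (fun x : M => \sum_(i <- [::]) F i x) = fun=> 0.
    by apply/funext => u; rewrite big_nil.
  rewrite big_nil; split; first by move=> x; exact: cst_continuous.
  by rewrite Rintegral_cst// mul0r.
have -> : (fun u => \sum_(j <- i :: r) F j u) =
    fun u => 1 * F i u + \sum_(j <- r) F j u.
  by apply/funext => u; rewrite big_cons mul1r.
split; first exact: continuous_lin.
by rewrite int_lin// IH2 big_cons mul1r.
Qed.

(** The volume can only be evaluated on functions supported in a chart. Multiplying by a bump
    [phi <= K] around [x0] gives such a function, with positive coordinate integral, and
    [f phi <= K f]. *)
Lemma int_gt0 f x0 : continuous f -> (forall x, 0 <= f x) -> 0 < f x0 ->
  0 < \int[mu]_x f x.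
Proof.
move=> cf f0 fx0; set c := chart_at x0.
have [phi [p1 p2 p3 p4]] := CkM_bump (@openT M) (I : setT x0) (chart_atP x0).
rewrite setTI in p4; have cp := CkM_continuous p1.
have [K hK] : exists K : R, forall x, phi x <= K.
  have [y _ hy] := compact_EVT_max (ex_intro _ x0 I) hcompact (continuous_subspaceT cp).
  by exists (phi y) => x; exact: (hy x (mem_set I)).
have K0 : 0 < K by exact: lt_le_trans (hK x0).
have cfp : continuous (fun x => f x * phi x) by move=> x; exact: (cvgM (cf x) (cp x)).
have sfp : closure [set x | f x * phi x != 0] `<=` dom c.
  apply: subset_trans p4; apply: closureS => x /=.
  by apply: contra_neq => ->; rewrite mulr0.
have h : \int[mu]_x (f x * phi x) <= K * \int[mu]_x f x.
  rewrite -RintegralZl//; last exact: continuous_integrable.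
  apply: le_Rintegral => //; [exact: continuous_integrable| |].
    exact: (integrableZl measurableT K (continuous_integrable cf)).
  by move=> x _; rewrite mulrC ler_wpM2r.
rewrite -(pmulr_rgt0 _ K0); apply: lt_le_trans h.
rewrite (hmu cfp sfp).
pose G (u : 'rV[R]_n) := (f (param c u) * phi (param c u)) * vol_density g c u.
rewrite -[X in patch _ _ X]/G.
have [h1 h2] : Ck_on 0 setT (patch (fun=> 0) (img c) G) /\
    exists K : R, csupp K (patch (fun=> 0) (img c) G).
  apply: (chart_patch hcompact (@closed_closure _ [set x | f x * phi x != 0]) sfp).
    split=> // u cu; rewrite /G.
    have cpar : {for u, continuous (fun u => f (param c u) * phi (param c u))}.
      apply: (@continuous_comp _ _ _ (param c) (fun x => f x * phi x)).
        exact: continuous_param.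
      exact: cfp.
    exact: (cvgM cpar (Ck_on_continuous (Ck_on_vol_density g 0 c) cu)).
  move=> u cu Su; rewrite /G; apply/eqP; rewrite mulf_eq0; apply/orP; left.
  by apply/negPn/negP => nz; apply: Su; exact: subset_closure.
have c0 : img c (coord c x0) by apply: img_coord; exact: chart_atP.
apply: (@integral_rV_gt0 _ _ _ (coord c x0)).
- by split=> // u; exact: (Ck_on_continuous h1).
- move=> u; rewrite patchE; case: ifPn => // /set_mem cu.
  by rewrite /G mulr_ge0// ?mulr_ge0// ltW// vol_density_gt0.
- rewrite patchE mem_set// /G mulr_gt0 ?vol_density_gt0// coordK ?mulr_gt0//.
  exact: chart_atP.
Qed.

(** The formula of [div] with the chart as a parameter; [div] at [x] is the case [chart_at x]. With
    the chart fixed, the expression can be differentiated and integrated. *)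
Definition local_div (X : vfield M) (c : chart M) (u : 'rV[R]_n) : R :=
  (vol_density g c u)^-1 *
    \sum_(i < n) partial i (fun v => vol_density g c v * X c v 0 i) u.

Lemma Ck_on_flux k rho theta c i : CkM k rho -> CkM k.+1 theta ->
  Ck_on k (img c) (fun v => vol_density g c v *
    scale_vfield rho (grad g theta) c v 0 i).
Proof.
move=> hr ht; have oc := @open_chart_img _ _ _ c.
apply: Ck_on_mul => //; first exact: Ck_on_vol_density.
have h : Ck_on k (img c) (fun v => rho (param c v) * \sum_(j < n)
    partial j (fun v => theta (param c v)) v * invmx (g c v) j i).
  apply: Ck_on_mul => //.
  apply: Ck_on_sum => // j _; apply: Ck_on_mul => //; first exact: CkM_partial.
  exact: Ck_on_inv_gmx.
apply: (Ck_on_ext oc _ h) => u _; rewrite mxE /grad mxE; congr (_ * _).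
by apply: eq_bigr => j _; rewrite mxE.
Qed.

Lemma Ck_on_local_div k rho theta c : CkM k.+1 rho -> CkM k.+2 theta ->
  Ck_on k (img c) (local_div (scale_vfield rho (grad g theta)) c).
Proof.
move=> hr ht; have oc := @open_chart_img _ _ _ c.
apply: Ck_on_mul => //.
  apply: Ck_on_inv => //; last exact: Ck_on_vol_density.
  by move=> u cu; rewrite gt_eqF// vol_density_gt0.
by apply: Ck_on_sum => // i _; have [_ /(_ i)[]] := Ck_on_flux c i hr ht.
Qed.

(** Stands for [phi] times the divergence as long as the latter is only known chart by chart. *)
Definition cut_div (X : vfield M) (c : chart M) phi : M -> R :=
  patch (fun=> 0) (dom c) (fun x => phi x * local_div X c (coord c x)).

Section Local.
Variables (rho theta phi : M -> R) (c : chart M).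
Hypotheses (hr : CkM 1 rho) (ht : CkM 2 theta) (hp : CkM 1 phi)
  (sp : closure [set x | phi x != 0] `<=` dom c).
Let X := scale_vfield rho (grad g theta).
Let S := closure [set x | phi x != 0].

Let phi0 x : ~ S x -> phi x = 0.
Proof. by move=> Sx; apply/eqP/negPn/negP => nz; apply: Sx; exact: subset_closure. Qed.

Lemma cut_divE u : img c u -> cut_div X c phi (param c u) = phi (param c u) * local_div X c u.
Proof.
by move=> cu; rewrite /cut_div patchE mem_set ?paramK//; exact: dom_param.
Qed.

Lemma cut_div_continuous : continuous (cut_div X c phi).
Proof.
move=> x; have [cx|cx] := pselect (dom c x).
  apply: (continuous_at_chart cx).
  have h : Ck_on 0 (img c) (fun u => phi (param c u) * local_div X c u).
    apply: Ck_on_mul; [exact: open_chart_img|exact: (Ck_onW (hp c))|exact: Ck_on_local_div].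
  apply: (@near_eq_continuous_at _ _ _ _ _ _ (Ck_on_continuous h (img_coord cx))).
  apply: (open_near_eq (@open_chart_img _ _ _ c)); last exact: img_coord.
  by move=> u cu; rewrite cut_divE.
have Sx : ~ S x by move/sp.
have c0 : {for x, continuous (fun=> 0 : R)} by exact: cst_continuous.
apply: near_eq_continuous_at c0.
have : nbhs x (~` S) by apply: open_nbhs_nbhs; split=> //; exact/closed_openC/closed_closure.
by apply: filterS => y Sy; rewrite /cut_div patchE; case: ifPn => // _; rewrite phi0// mul0r.
Qed.

(** Both integrands are supported in [dom c], so both integrals can be read in coordinates. There
    the volume density turns the field into the flux [W] of [chart_ibp] and cancels the inverse
    density in [local_div]. *)
Lemma local_divergence :
  \int[mu]_x (ip g theta phi x * rho x) = - \int[mu]_x cut_div X c phi x.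
Proof.
have ht1 := CkM_leq (isT : (1 <= 2)%N) ht.
have cip : continuous (fun x => ip g theta phi x * rho x).
  by apply: (@CkM_continuous _ _ _ 0); apply: CkM_mul;
    [exact: CkM_ip|exact: CkM_leq hr].
have cS : closed S by exact: closed_closure.
have S0 x : ~ S x -> ip g theta phi x = 0.
  move=> Sx; rewrite /ip local_ipE big1// => i _.
  rewrite (@partial_phi0 _ _ _ (chart_at x) S) ?mulr0//.
    by apply: img_coord; exact: chart_atP.
  by rewrite coordK//; exact: chart_atP.
have clS (f : M -> R) : (forall x, ~ S x -> f x = 0) ->
    closure [set x | f x != 0] `<=` dom c.
  move=> f0; apply: subset_trans sp; rewrite -/S [in X in _ `<=` X](_ : S = closure S).
    apply: closureS => y /= fy; apply: contrapT => /f0 fy0.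
    by rewrite fy0 eqxx in fy.
  exact/closure_id.
rewrite (@hmu c _ cip); last by apply: clS => x /S0 ->; rewrite mul0r.
rewrite (@hmu c _ cut_div_continuous); last first.
  apply: clS => x Sx; rewrite /cut_div patchE; case: ifPn => // _.
  by rewrite phi0// mul0r.
have pE (F G : 'rV[R]_n -> R) : (forall u, img c u -> F u = G u) ->
    patch (fun=> 0) (img c) F = patch (fun=> 0) (img c) G.
  by move=> FG; apply/funext => u; rewrite !patchE; case: ifPn => // /set_mem/FG.
transitivity (integral_rV (patch (fun=> 0) (img c) (fun u => \sum_(i < n)
    (vol_density g c u * X c u 0 i) * partial i (fun v => phi (param c v)) u))).
  congr integral_rV; apply: pE => u cu; rewrite ip_param// local_ipE !mulr_suml.
  apply: eq_bigr => i _; rewrite mxE /grad mxE.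
  have -> : \sum_(j < n) (\row_j0 partial j0 (fun v => theta (param c v)) u) 0 j *
      invmx (g c u) j i =
      \sum_(j < n) partial j (fun v => theta (param c v)) u * invmx (g c u) j i.
    by apply: eq_bigr => j _; rewrite mxE.
  by ring.
rewrite (chart_ibp hcompact cS sp hp phi0 (fun i => Ck_on_flux c i hr ht)).
congr (- integral_rV _); apply: pE => u cu; rewrite cut_divE// /local_div.
have v0 : vol_density g c u != 0 by rewrite gt_eqF// vol_density_gt0.
by rewrite -mulrA; congr (_ * _); rewrite mulrAC mulVf// mul1r.
Qed.

End Local.
End Volume.

(** * From one chart to the whole manifold *)

Section Divergence.
Context (R : realType) (n : nat) (M : smoothManifold R n) (g : riemannianMetric M).
Context (mu : probability (borel M) R).
Hypotheses (hcompact : compact [set: M]) (hmu : is_riemannian_volume g mu).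
Implicit Types (c d : chart M) (f rho theta phi : M -> R) (x : M).

Lemma local_div_continuous rho theta c x : CkM 1 rho -> CkM 2 theta -> dom c x ->
  {for x, continuous (fun y => local_div g (scale_vfield rho (grad g theta)) c (coord c y))}.
Proof.
move=> hr ht cx; apply: (@continuous_comp _ _ _ (coord c)
  (local_div g (scale_vfield rho (grad g theta)) c)).
  exact: continuous_coord.
exact: (Ck_on_continuous (Ck_on_local_div g c (k := 0) hr ht) (img_coord cx)).
Qed.

(* Both sides have the same integral against test functions, namely minus the
   integral of the derivative of the test function along the field. *)
Lemma local_div_change_chart rho theta c d x : CkM 1 rho -> CkM 2 theta ->
  dom c x -> dom d x ->
  local_div g (scale_vfield rho (grad g theta)) c (coord c x) =
  local_div g (scale_vfield rho (grad g theta)) d (coord d x).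
Proof.
move=> hr ht; set X := scale_vfield rho (grad g theta).
(* The situation is symmetric in [c] and [d], so an inequality suffices. *)
wlog suff: c d / dom c x -> dom d x ->
    local_div g X c (coord c x) <= local_div g X d (coord d x).
  by move=> le cx dx; apply/le_anti/andP; split; exact: le.
move=> cx dx; rewrite leNgt; apply/negP => lt.
pose h y := local_div g X c (coord c y) - local_div g X d (coord d y).
have ch : {for x, continuous h}.
  exact: (cvgB (local_div_continuous hr ht cx) (local_div_continuous hr ht dx)).
have hx : 0 < h x by rewrite subr_gt0.
have : nbhs x (h @^-1` [set r | 0 < r]) by apply: ch; exact: lt_nbhsr.
rewrite nbhsE => -[W [oW Wx] Wh].
have oWd : open (W `&` dom d) by apply: openI => //; exact: open_dom.
(* The bump is supported in both charts and where [h > 0]: the two cut-off divergences have equal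
   integrals, yet their difference [phi h] is nonnegative and positive at [x]. *)
have [phi [p1 p2 p3 p4]] := CkM_bump oWd (conj Wx dx) cx.
have pc : closure [set x | phi x != 0] `<=` dom c by move=> y /p4[].
have pd : closure [set x | phi x != 0] `<=` dom d by move=> y /p4[[]].
have cutc := cut_div_continuous hr ht p1 pc; have cutd := cut_div_continuous hr ht p1 pd.
have E y : -1 * cut_div g X d phi y + cut_div g X c phi y = phi y * h y.
  have [py|py] := eqVneq (phi y) 0.
    by rewrite /cut_div !patchE py !mul0r !if_same mulr0 addr0.
  have Sy : closure [set x | phi x != 0] y by exact: subset_closure.
  rewrite /cut_div !patchE !mem_set; [|exact: pc|exact: pd].
  by rewrite /h mulN1r addrC mulrBr.
have : 0 < \int[mu]_y (-1 * cut_div g X d phi y + cut_div g X c phi y).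
  apply: (@int_gt0 _ _ _ _ _ hcompact hmu _ x).
  - exact: continuous_lin.
  - move=> y; rewrite E; have [->|py] := eqVneq (phi y) 0; first by rewrite mul0r.
    have Sy : closure [set x | phi x != 0] y by exact: subset_closure.
    have [[Wy _] _] := p4 y Sy; exact: (mulr_ge0 (p2 y) (ltW (Wh y Wy))).
  - by rewrite E mulr_gt0.
have Lc := local_divergence hcompact hmu hr ht p1 pc.
have Ld := local_divergence hcompact hmu hr ht p1 pd.
have aux (a b z : R) : z = - a -> z = - b -> 0 < -1 * b + a -> False.
  by move=> -> /oppr_inj ->; rewrite mulN1r addNr ltxx.
by rewrite int_lin//; exact: (aux _ _ _ Lc Ld).
Qed.

Lemma div_param rho theta c u : CkM 1 rho -> CkM 2 theta -> img c u ->
  div g (scale_vfield rho (grad g theta)) (param c u) =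
  local_div g (scale_vfield rho (grad g theta)) c u.
Proof.
move=> hr ht cu; rewrite -[u in RHS](paramK cu).
by apply: local_div_change_chart => //; [exact: chart_atP|exact: dom_param].
Qed.

Lemma CkM_div k rho theta : CkM k.+1 rho -> CkM k.+2 theta ->
  CkM k (div g (scale_vfield rho (grad g theta))).
Proof.
move=> hr ht c; apply: (Ck_on_ext (@open_chart_img _ _ _ c) _ (Ck_on_local_div g c hr ht)).
move=> u cu; rewrite div_param//; first exact: (CkM_leq (isT : (1 <= k.+1)%N)).
exact: (CkM_leq (isT : (2 <= k.+2)%N)).
Qed.

Lemma ip_sumr (I : Type) (r : seq I) theta (F : I -> M -> R) x :
  (forall i, CkM 1 (F i)) ->
  ip g theta (fun x => \sum_(i <- r) F i x) x = \sum_(i <- r) ip g theta (F i) x.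
Proof.
move=> hF; elim: r => [|i r IH].
  have -> : (fun x : M => \sum_(i <- [::]) F i x) = fun x => 0 + 0 * 0.
    by apply/funext => y; rewrite big_nil mulr0 addr0.
  rewrite big_nil (@ip_linr _ _ _ g 0 theta (fun=> 0) (fun=> 0)); [|exact: CkM_cst|exact: CkM_cst].
  rewrite mul0r addr0 /ip local_ipE big1// => j _.
  by rewrite /partial derive_cst mulr0.
rewrite big_cons -IH -[X in _ + X]mul1r -ip_linr//; last exact: CkM_sum.
by congr (ip g theta _ x); apply/funext => y; rewrite big_cons mul1r.
Qed.

Lemma divergence_theorem rho theta phi : CkM 1 rho -> CkM 2 theta -> CkM 1 phi ->
  \int[mu]_x (ip g theta phi x * rho x) =
  - \int[mu]_x (phi x * div g (scale_vfield rho (grad g theta)) x).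
Proof.
move=> hr ht hp; set X := scale_vfield rho (grad g theta).
have ht1 := CkM_leq (isT : (1 <= 2)%N) ht.
have [s [chi [c1 c2 c3]]] := partition_of_unity hcompact.
pose F y x := phi x * chi y x.
have hF y : CkM 1 (F y) := CkM_mul hp (c1 y).
have sF y : closure [set x | F y x != 0] `<=` dom (chart_at y).
  apply: subset_trans (c2 y); apply: closureS => x /=.
  by apply: contra_neq => h; rewrite /F h mulr0.
have phiE : phi = fun x => \sum_(y <- s) F y x.
  by apply/funext => x; rewrite -mulr_sumr c3 mulr1.
(* Independence of the chart enters here: every piece, though cut off in its own chart, is a
   multiple of the same function [div g X], so the pieces can be summed. *)
have cdE y x : cut_div g X (chart_at y) (F y) x = F y x * div g X x.
  rewrite /cut_div patchE; case: ifPn => [/set_mem yx|/negP yx].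
    by rewrite (local_div_change_chart hr ht yx (chart_atP x)).
  have [->|Fx] := eqVneq (F y x) 0; first by rewrite mul0r.
  by case: yx; apply: mem_set; apply: sF; exact: subset_closure.
have cip y : continuous (fun x => ip g theta (F y) x * rho x).
  exact: (CkM_continuous (CkM_mul (CkM_ip g (k := 0) ht1 (hF y))
    (CkM_leq (leq0n 1) hr))).
have ccd y : continuous (cut_div g X (chart_at y) (F y)) :=
  cut_div_continuous hr ht (hF y) (sF y).
transitivity (\int[mu]_x (\sum_(y <- s) ip g theta (F y) x * rho x)).
  by apply: eq_Rintegral => x _; rewrite {1}phiE ip_sumr// mulr_suml.
rewrite (int_sum mu hcompact s cip).2.
under eq_bigr do rewrite (local_divergence hcompact hmu hr ht (hF _) (sF _)).
rewrite sumrN -(int_sum mu hcompact s ccd).2; congr (- _).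
apply: eq_Rintegral => x _; rewrite {1}phiE mulr_suml.
by apply: eq_bigr => y _; rewrite cdE.
Qed.

End Divergence.

(** * Time slices of smooth curves *)

Lemma Ck_on_slice (R : realType) (n k : nat) (T : set R) (V : set 'rV[R]_n)
    (F : 'rV[R]_n.+1 -> R) (U : set 'rV[R]_n.+1) (t : R) :
  (forall u, V u -> U (consv t u)) -> Ck_on k U F -> Ck_on k V (slice F t).
Proof.
move=> VU; elim: k F => [|k IH] F hF.
  split=> // u Vu; apply: (@continuous_comp _ _ _ (consv t) F).
    exact: consv_continuous.
  exact: (Ck_on_continuous hF (VU _ Vu)).
have [cF hp] := hF; split=> [u Vu|i].
  apply: (@continuous_comp _ _ _ (consv t) F); first exact: consv_continuous.
  exact: cF (VU _ Vu).
have [dF pF] := hp (lift ord0 i).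
(* Coordinate 0 is the time, so the line along space coordinate [i] is the line along coordinate
   [lift ord0 i] of space-time, and slicing commutes with space derivatives. *)
have E u : (fun h : R => slice F t (h *: (delta_mx 0 i : 'rV[R]_n) + u)) =
    (fun h : R => F (h *: (delta_mx 0 (lift ord0 i) : 'rV[R]_n.+1) + consv t u)).
  apply/funext => h; congr F; apply/rowP => j.
  rewrite [RHS]mxE [X in _ = X + _]mxE [X in _ = _ * X + _]mxE.
  case: (unliftP ord0 j) => [l ->|->].
    by rewrite !consvEr !mxE (inj_eq (@lift_inj _ _)).
  by rewrite !consvEl (negbTE (neq_lift _ _)) andbF mulr0 add0r.
have pE : partial i (slice F t) = slice (partial (lift ord0 i) F) t.
  by apply/funext => u; rewrite /slice /partial [LHS]derive_line [RHS]derive_line -E.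
split; last by rewrite pE; exact: IH.
move=> u /VU/dF /derivable1P; rewrite -E => d; exact: (iffRL (derivable1P _ _ _) d).
Qed.

Lemma smooth_curve_at (R : realType) (n : nat) (M : smoothManifold R n) (I : set R)
    (f : R -> M -> R) t : smooth_curve I f -> I t -> smooth (f t).
Proof.
move=> hf It c k.
have h := hf c k.
have {}h := @Ck_on_slice R n k I (img c) _ _ t _ h.
have lK (u : 'rV[R]_n) : lsubmx (consv t u : 'rV[R]_(1 + n)) = const_mx t by exact: row_mxKl.
have rK (u : 'rV[R]_n) : rsubmx (consv t u : 'rV[R]_(1 + n)) = u by exact: row_mxKr.
apply: (Ck_on_ext (@open_chart_img _ _ _ c) _ (h _)).
  by move=> u cu; rewrite /slice lK rK mxE.
by move=> u cu; rewrite /= lK rK mxE.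
Qed.

(** * Variational derivatives *)

Lemma is_derive_quadratic (R : realType) (A B C : R) :
  is_derive (0 : R) (1 : R) (fun e : R => A + e * B + e ^+ 2 * C) B.
Proof.
have -> : (fun e : R => A + e * B + e ^+ 2 * C) =
    horner (A%:P + B *: 'X + C *: 'X^2).
  by apply/funext => e; rewrite !hornerE/=; ring.
split; first exact: derivable_horner.
rewrite -derive1E -derivE !derivD derivC !derivZ derivX derivXn !hornerE/=; ring.
Qed.

(** The profile of the Hamiltonian along [rho + e * phi], with [m + e * m1] the mass.
    Differentiating the inverse mass produces the last term, the source of the [xi^2 / 2] in the
    equation for [theta]. *)
Lemma is_derive_rational (R : realType) (A B a b m m1 : R) : m != 0 ->
  is_derive (0 : R) (1 : R)
    (fun e : R => 2^-1 * (A + e * B) + (2 * (m + e * m1))^-1 * (a + e * b) ^+ 2)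
    (2^-1 * B + m^-1 * a * b - (m^-1 * a) ^+ 2 / 2 * m1).
Proof.
move=> m0.
have q1 := is_derive_quadratic (2^-1 * A) (2^-1 * B) 0.
have q2 := is_derive_quadratic (2 * m) (2 * m1) 0.
have q3 := is_derive_quadratic (a ^+ 2) (2 * a * b) (b ^+ 2).
set f1 := fun e : R => _ in q1; set f2 := fun e : R => _ in q2; set f3 := fun e : R => _ in q3.
have f20 : f2 0 = 2 * m by rewrite /f2; ring.
have f30 : f3 0 = a ^+ 2 by rewrite /f3; ring.
have n0 : f2 0 != 0 by rewrite f20 mulf_neq0.
have [d2 e2] := q2.
have i2 : is_derive (0 : R) (1 : R) (fun e => (f2 e)^-1) (- (f2 0) ^- 2 * (2 * m1)).
  by split; [exact: derivableV|rewrite deriveV// e2].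
have [d1 e1] := q1; have [d3 e3] := q3; have [di ei] := i2.
have -> : (fun e : R => 2^-1 * (A + e * B) + (2 * (m + e * m1))^-1 * (a + e * b) ^+ 2) =
    fun e => f1 e + (f2 e)^-1 * f3 e.
  apply/funext => e; rewrite /f1 /f2 /f3; congr (_ + _ * _); [ring| |ring].
  by congr (_ ^-1); ring.
split; first exact: (derivableD d1 (derivableM di d3)).
have -> := deriveD d1 (derivableM di d3).
have -> := deriveM di d3.
rewrite e1 ei e3 /GRing.scale/= f20 f30.
by field.
Qed.

Section Hamilton.
Context (R : realType) (n : nat) (M : smoothManifold R n) (g : riemannianMetric M).
Context (mu : probability (borel M) R).
Hypotheses (hcompact : compact [set: M]) (hmu : is_riemannian_volume g mu).
Context (rho theta : M -> R).
Hypotheses (hrho : is_volume_form rho) (htheta : smooth theta).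

Let kr k : CkM k rho. Proof. by apply: (smoothP rho).1; case: hrho. Qed.
Let kt k : CkM k theta. Proof. exact: (smoothP theta).1. Qed.

Definition theta_gradient (x : M) : R :=
  - div g (scale_vfield rho (grad g theta)) x + xi mu rho theta * rho x.

Definition rho_gradient (x : M) : R :=
  2^-1 * normsq g (grad g theta) x + xi mu rho theta * theta x
  - xi mu rho theta ^+ 2 / 2.

Lemma mass_gt0 : 0 < mass mu rho.
Proof.
have [_ r0] := hrho; apply: (int_gt0 hcompact hmu (x0 := point)) => //.
  exact: (CkM_continuous (kr 0)).
by move=> x; rewrite ltW.
Qed.

Lemma smooth_theta_gradient : smooth theta_gradient.
Proof.
apply/smoothP => k; apply: CkM_add.
  by apply: CkM_opp; exact: (CkM_div hcompact hmu).
by apply: CkM_mul => //; exact: CkM_cst.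
Qed.

Lemma smooth_rho_gradient : smooth rho_gradient.
Proof.
apply/smoothP => k; apply: CkM_add; last exact: CkM_cst.
apply: CkM_add; last by apply: CkM_mul => //; exact: CkM_cst.
apply: CkM_mul; first exact: CkM_cst.
have -> : normsq g (grad g theta) = ip g theta theta.
  by apply/funext => x; exact: normsq_grad.
exact: CkM_ip.
Qed.

Lemma vderiv_theta : is_vderiv_theta mu (hamiltonian g mu) rho theta theta_gradient.
Proof.
split; first exact: smooth_theta_gradient.
move=> phi /smoothP hp; have m0 := mass_gt0.
have m1 : mass mu rho != 0 by rewrite gt_eqF.
set A := \int[mu]_x (ip g theta theta x * rho x).
set B := \int[mu]_x (ip g theta phi x * rho x).
set C := \int[mu]_x (ip g phi phi x * rho x).
set a := \int[mu]_x (theta x * rho x).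
set b := \int[mu]_x (phi x * rho x).
have ci f h : CkM 1 f -> CkM 1 h -> continuous (fun x => ip g f h x * rho x).
  by move=> hf hh; exact: (CkM_continuous (CkM_mul (CkM_ip g (k := 0) hf hh) (kr 0))).
have cr f : CkM 1 f -> continuous (fun x => f x * rho x).
  by move=> hf; exact: (CkM_continuous (CkM_mul hf (kr 1))).
have cA := ci theta theta (kt 1) (kt 1).
have cB := ci theta phi (kt 1) (hp 1%N).
have cC := ci phi phi (hp 1%N) (hp 1%N).
(* Sorted by powers of [e], so that the derivative at 0 is the coefficient of [e]. *)
have HE e : hamiltonian g mu rho (fun x => theta x + e * phi x) =
    (2^-1 * A + (2 * mass mu rho)^-1 * a ^+ 2) + e * (B + (mass mu rho)^-1 * a * b) +
    e ^+ 2 * (2^-1 * C + (2 * mass mu rho)^-1 * b ^+ 2).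
  have E1 : \int[mu]_x (normsq g (grad g (fun x => theta x + e * phi x)) x * rho x) =
      e ^+ 2 * C + (2 * e * B + A).
    have L := int_lin mu hcompact (2 * e) cB cA.
    have L' := int_lin mu hcompact (e ^+ 2) cC (continuous_lin (a := (2 * e)) cB cA).
    apply: (etrans _ (etrans L' (congr1 (fun z => e ^+ 2 * C + z) L))).
    apply: eq_Rintegral => x _; rewrite normsq_grad ip_quadratic//; ring.
  have E2 : \int[mu]_x ((theta x + e * phi x) * rho x) = e * b + a.
    apply: (etrans _ (int_lin mu hcompact e (cr phi (hp 1%N)) (cr theta (kt 1)))).
    by apply: eq_Rintegral => x _; ring.
  by rewrite /hamiltonian E1 E2; field.
have -> : (fun e : R => hamiltonian g mu rho (fun x => theta x + e * phi x)) = _ :=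
  funext HE.
have -> : \int[mu]_x (phi x * theta_gradient x) = B + (mass mu rho)^-1 * a * b.
  have cd : continuous (fun x => phi x * div g (scale_vfield rho (grad g theta)) x).
    exact: (CkM_continuous (CkM_mul (hp 0%N) (CkM_div hcompact hmu (kr 1) (kt 2)))).
  have cb := cr phi (hp 1%N).
  (* A zero summand brings a plain multiple into the form [a * f + h] that [int_lin] expects. *)
  have c0 : continuous (fun _ : M => 0 : R) by move=> x; exact: cst_continuous.
  have L := int_lin mu hcompact (xi mu rho theta) cb c0.
  have L' := int_lin mu hcompact (-1) cd (continuous_lin (a := (xi mu rho theta)) cb c0).
  have L0 : \int[mu]_(_ in [set: M]) (0 : R) = 0 by rewrite Rintegral_cst// mul0r.
  have D := divergence_theorem hcompact hmu (kr 1) (kt 2) (hp 1%N).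
  apply: etrans (etrans (_ : _ = _) L') _.
    by apply: eq_Rintegral => x _; rewrite /theta_gradient; ring.
  by rewrite L L0 addr0 mulN1r -D.
exact: is_derive_quadratic.
Qed.

Lemma vderiv_rho : is_vderiv_rho mu (hamiltonian g mu) rho theta rho_gradient.
Proof.
split; first exact: smooth_rho_gradient.
move=> phi /smoothP hp; have m0 := mass_gt0.
have m1 : mass mu rho != 0 by rewrite gt_eqF.
set A := \int[mu]_x (ip g theta theta x * rho x).
set B := \int[mu]_x (ip g theta theta x * phi x).
set a := \int[mu]_x (theta x * rho x).
set b := \int[mu]_x (theta x * phi x).
set m' := \int[mu]_x phi x.
have ci f : CkM 1 f -> continuous (fun x => ip g theta theta x * f x).
  move=> hf; exact: (CkM_continuous (CkM_mul (CkM_ip g (k := 1) (kt 2) (kt 2)) hf)).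
have ct f : CkM 1 f -> continuous (fun x => theta x * f x).
  by move=> hf; exact: (CkM_continuous (CkM_mul (kt 1) hf)).
have cA := ci rho (kr 1); have cB := ci phi (hp 1%N).
have ca := ct rho (kr 1); have cb := ct phi (hp 1%N).
have cp : continuous phi := CkM_continuous (hp 0%N).
(* By linearity this holds for every [e], also where [rho + e * phi] fails to be positive; the same
   inverse of the mass stands on both sides. *)
have HE e : hamiltonian g mu (fun x => rho x + e * phi x) theta =
    2^-1 * (A + e * B) + (2 * (mass mu rho + e * m'))^-1 * (a + e * b) ^+ 2.
  have E1 : \int[mu]_x (normsq g (grad g theta) x * (rho x + e * phi x)) = e * B + A.
    apply: (etrans _ (int_lin mu hcompact e cB cA)).
    by apply: eq_Rintegral => x _; rewrite normsq_grad; ring.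
  have E2 : \int[mu]_x (theta x * (rho x + e * phi x)) = e * b + a.
    apply: (etrans _ (int_lin mu hcompact e cb ca)).
    by apply: eq_Rintegral => x _; ring.
  have E3 : mass mu (fun x => rho x + e * phi x) = e * m' + mass mu rho.
    apply: (etrans _ (int_lin mu hcompact e cp (CkM_continuous (kr 0)))).
    by apply: eq_Rintegral => x _; rewrite addrC.
  by rewrite /hamiltonian E1 E2 E3 (addrC (e * B)) (addrC (e * b)) (addrC (e * m')).
have -> : (fun e : R => hamiltonian g mu (fun x => rho x + e * phi x) theta) = _ :=
  funext HE.
have -> : \int[mu]_x (rho_gradient x * phi x) =
    2^-1 * B + (mass mu rho)^-1 * a * b - ((mass mu rho)^-1 * a) ^+ 2 / 2 * m'.
  have c0 : continuous (fun _ : M => 0 : R) by move=> x; exact: cst_continuous.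
  set z := xi mu rho theta.
  have c1 := continuous_lin (a := (- (z ^+ 2 / 2))) cp c0.
  have c2 := continuous_lin (a := z) cb c1.
  have L0 : \int[mu]_(_ in [set: M]) (0 : R) = 0 by rewrite Rintegral_cst// mul0r.
  have L1 := int_lin mu hcompact (- (z ^+ 2 / 2)) cp c0.
  have L2 := int_lin mu hcompact z cb c1.
  have L3 := int_lin mu hcompact 2^-1 cB c2.
  apply: etrans (etrans (_ : _ = _) L3) _.
    by apply: eq_Rintegral => x _; rewrite /rho_gradient normsq_grad -/z; ring.
  by rewrite L2 L1 L0 addr0 -/b -/m' -/B mulNr addrA.
exact: is_derive_rational.
Qed.

End Hamilton.

(** * Uniqueness of the variational derivatives and the equivalence *)

Section Uniqueness.
Context (R : realType) (n : nat) (M : smoothManifold R n) (g : riemannianMetric M).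
Context (mu : probability (borel M) R).
Hypotheses (hcompact : compact [set: M]) (hmu : is_riemannian_volume g mu).

Lemma smooth_int_inj (D E : M -> R) : smooth D -> smooth E ->
  (forall phi, smooth phi -> \int[mu]_x (phi x * D x) = \int[mu]_x (phi x * E x)) ->
  D = E.
Proof.
move=> /smoothP hD /smoothP hE DE; apply/funext => x0; apply/eqP.
rewrite -subr_eq0; apply/negPn/negP => nz.
pose phi x := D x + -1 * E x.
have hphi k : CkM k phi by apply: CkM_add => //; apply: CkM_mul => //; exact: CkM_cst.
have c f : (forall k, CkM k f) -> continuous (fun x => phi x * f x).
  by move=> hf; apply: (@CkM_continuous _ _ _ 0); exact: CkM_mul.
have : 0 < \int[mu]_x (-1 * (phi x * E x) + phi x * D x).
  apply: (int_gt0 hcompact hmu (x0 := x0)).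
  - by apply: continuous_lin; exact: c.
  - move=> x; have -> : -1 * (phi x * E x) + phi x * D x = phi x ^+ 2.
      by rewrite /phi; ring.
    exact: sqr_ge0.
  - have -> : -1 * (phi x0 * E x0) + phi x0 * D x0 = (D x0 - E x0) ^+ 2.
      by rewrite /phi; ring.
    by rewrite exprn_even_gt0.
have -> := int_lin mu hcompact (-1) (c E hE) (c D hD).
by rewrite DE ?mulN1r ?addNr ?ltxx//; exact/smoothP.
Qed.

Lemma vderiv_theta_unique H (rho theta D E : M -> R) :
  is_vderiv_theta mu H rho theta D -> is_vderiv_theta mu H rho theta E -> D = E.
Proof.
move=> [sD hD] [sE hE]; apply: smooth_int_inj => // phi sphi.
by have [_ <-] := hD _ sphi; have [_ ->] := hE _ sphi.
Qed.

Lemma vderiv_rho_unique H (rho theta D E : M -> R) :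
  is_vderiv_rho mu H rho theta D -> is_vderiv_rho mu H rho theta E -> D = E.
Proof.
move=> [sD hD] [sE hE]; apply: smooth_int_inj => // phi sphi.
have C (F : M -> R) : \int[mu]_x (phi x * F x) = \int[mu]_x (F x * phi x).
  by apply: eq_Rintegral => x _; rewrite mulrC.
by rewrite !C; have [_ <-] := hD _ sphi; have [_ ->] := hE _ sphi.
Qed.

End Uniqueness.

Theorem theorem2p6 (R : realType) (n : nat) (M : smoothManifold R n)
    (g : riemannianMetric M) (mu : probability (borel M) R)
    (hcompact : compact [set: M]) (hconnected : connected [set: M])
    (hmu : is_riemannian_volume g mu)
    (I : set R) (hIopen : open I) (hIinterval : is_interval I)
    (rho theta : R -> M -> R)
    (hrho : smooth_curve I rho)
    (hrho_vol : forall t, I t -> is_volume_form (rho t))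
    (htheta : smooth_curve I theta) :
  forall t, I t ->
    hamilton_equations mu (hamiltonian g mu) rho theta t <->
    forall x : M,
      time_deriv rho t x =
        - div g (scale_vfield (rho t) (grad g (theta t))) x
        + xi mu (rho t) (theta t) * rho t x /\
      time_deriv theta t x =
        - (2^-1 * normsq g (grad g (theta t)) x)
        - xi mu (rho t) (theta t) * theta t x
        + xi mu (rho t) (theta t) ^+ 2 / 2.
Proof.
move=> t It; have vt := hrho_vol t It; have st := smooth_curve_at htheta It.
have Vt := vderiv_theta hcompact hmu vt st.
have Vr := vderiv_rho hcompact hmu vt st.
(* The second Hamilton equation determines minus the time derivative of [theta]; this converts it to
   the stated sign. *)
have signs (a b c d : R) : a = - b - c + d <-> - a = b + c - d.
  by split=> [->|E]; [|rewrite -[a]opprK E]; ring.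
split=> [[ht hr] x|E].
  have -> : time_deriv rho t = theta_gradient g mu (rho t) (theta t).
    exact: (vderiv_theta_unique hcompact hmu ht Vt).
  split=> //; apply/signs.
  have := vderiv_rho_unique hcompact hmu hr Vr.
  by move=> /(congr1 (fun f => f x)).
split.
  (* The equations identify the time derivatives with the computed gradients as functions, so the
     smoothness demanded of a variational derivative is inherited from the gradients. *)
  have -> // : time_deriv rho t = theta_gradient g mu (rho t) (theta t).
  by apply/funext => x; have [] := E x.
have -> // : (fun x => - time_deriv theta t x) = rho_gradient g mu (rho t) (theta t).
by apply/funext => x; have [_ /signs] := E x.
Qed.
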